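(* Let $(A_n)$ be a sequence of real $n\times n$ matrices with $\mathrm{Tr}(A_n^TA_n)=n$ and \[\lim_{n\to\infty}\frac{1}{n}\sum_{i=1}^n(A_n)_{ii}=s\] for some constant $s$. Let $M$ be an $n\times n$ Haar-distributed random orthogonal matrix and $P$ an $n\times n$ uniformly random permutation matrix independent of $M$. Let $Z\sim\mathcal{N}(0,1-s^2)$ and $Y\sim\mathrm{Pois}(1)$ be independent. Then \[\mathrm{Tr}(A_nMPM^T)\xrightarrow{d}Z+sY\quad\text{as } n\to\infty.\]
   Context: Haar measure on $O(n)$ is the unique left- and right-invariant probability measure. *)

(* Defs.v *)
From HB Require Import structures.
From mathcomp Require Import all_boot all_order all_algebra all_fingroup.
From mathcomp Require Import all_classical all_reals all_analysis.
Set Implicit Arguments. Unset Strict Implicit. Unset Printing Implicit Defensive.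
Import Order.TTheory GRing.Theory Num.Theory.
Import numFieldNormedType.Exports.
Local Open Scope classical_set_scope.
Local Open Scope ring_scope.

Definition mxBorel (R : realType) (n : nat) :=
  g_sigma_algebraType (@open 'M[R]_n).

Definition orthogonal (R : realType) (n : nat) (M : 'M[R]_n) : Prop :=
  M *m M^T = 1%:M.

Definition is_Haar_On (R : realType) (n : nat)
    (mu : probability (mxBorel R n) R) : Prop :=
  mu [set M : 'M[R]_n | orthogonal M] = 1%E /\
  (forall Q : 'M[R]_n, orthogonal Q ->
     forall B : set (mxBorel R n), measurable B ->
       mu ((fun M : 'M[R]_n => Q *m M) @^-1` B) = mu B /\
       mu ((fun M : 'M[R]_n => M *m Q) @^-1` B) = mu B).

Definition expect_TrAMPMt (R : realType) (n : nat)
    (mu : probability (mxBorel R n) R) (A : 'M[R]_n) (f : R -> R) : R :=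
  (n`!%:R)^-1 * \sum_(sigma : 'S_n)
     Rintegral mu setT
       (fun M : 'M[R]_n => f (\tr (A *m M *m perm_mx sigma *m M^T))).

(* E[f(Z + s Y)] for Z ~ N(0, 1 - s^2) and Y ~ Pois(1) independent;
   Z is realised as sqrt(1 - s^2) G with G ~ N(0,1) (this also covers the
   degenerate variance 0 case, where Z = 0). *)
Definition expect_ZsY (R : realType) (s : R) (f : R -> R) : R :=
  \big[+%R/0%R]_(0 <= k <oo)
     (poisson_pmf 1 k *
      Rintegral (normal_prob 0 1) setT
        (fun x : R => f (Num.sqrt (1 - s ^+ 2) * x + s * k%:R))).

Definition cvg_in_distribution (R : realType)
    (E : nat -> (R -> R) -> R) (Elim : (R -> R) -> R) : Prop :=
  forall f : R -> R, continuous f -> (exists C : R, forall x, `|f x| <= C) ->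
    (fun n => E n f) @ \oo --> Elim f.

(* Main.v *)
(** Write [H = M P M^T], [s_n = tr A / n], [A0 = A - s_n I] and [W = tr (A0 H)], so that
    [tr (A H) = W + s_n N] with [N = tr P] the number of fixed points of the permutation.

    Conditionally on [P], [W] is nearly Gaussian with variance [1 - s_n^2]. Haar invariance
    under small plane rotations [M |-> R_e M] makes the coefficient of [e^2] in
    [E f (R_e M)] vanish; summing over all coordinate planes gives an integration by
    parts formula. For [f = cos (t W + b)] it says that
    [E (W sin (t W + b)) = (1 - s_n^2) t E (cos (t W + b))] up to errors bounded by the
    traces of words such as [A0 H A0 H], whose second moments are controlled by the same
    formula applied to their squares. A Gronwall argument in [t] turns this into
    [E (cos (t W + b)) = exp (- (1 - s_n^2) t^2 / 2) cos b + O(n^(-1/2))].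

    The identity [E_(n+1) (N h(N)) = E_n (h(N + 1))] yields the factorial moments of [N],
    hence its convergence to the Poisson law. Together these give the convergence of
    [E (cos (t X + b))], and uniform approximation of a continuous function on an interval
    by trigonometric polynomials, with the bound on [E |X|] for the tails, extends it to
    all bounded continuous test functions. *)

Require Import Defs.
From HB Require Import structures.
From mathcomp Require Import all_boot all_order all_algebra all_fingroup.
From mathcomp Require Import all_classical all_reals all_analysis.
From mathcomp Require Import measurable_realfun.
From mathcomp Require Import ring lra.
Set Implicit Arguments. Unset Strict Implicit. Unset Printing Implicit Defensive.
Import Order.TTheory GRing.Theory Num.Theory.
Import numFieldNormedType.Exports.
(* [orthogonal] must denote the predicate of [Defs], not the one on sesquilinear forms. *)
Import Defs.
Local Open Scope classical_set_scope.
Local Open Scope ring_scope.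

(** * Haar expectation *)

(** The test functions are [cos (t x + b)] rather than complex exponentials: the free phase [b]
    keeps everything real and absorbs [t s_n N], which is constant once the permutation is fixed.
    Centring [A] makes [W] almost an eigenfunction of the Laplacian of the group: the trace term in
    the second-order variation pairs to zero with a traceless matrix. Only almost, because the
    variation also produces [tr (A0 H^T)], so these two traces are estimated together. The error of
    the normal approximation involves [tr P] and [tr (P^2)], which can be as large as [n] for
    particular permutations; it is small only on average, hence the bound on the expected number of
    fixed points of a squared permutation. Matrix entries are unbounded on the whole matrix space,
    so all bounds and identities are compared on the orthogonal matrices, a set of full measure. *)

Section expectation.
Variables (R : realType) (n : nat) (mu : probability (mxBorel R n) R).
Hypothesis Hmu : is_Haar_On mu.
Local Notation MB := (mxBorel R n).

(** The bound is asked on orthogonal matrices only, since traces and entries are unbounded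
    elsewhere; it suffices for integrability because the complement is negligible. *)
Definition nice (f : MB -> R) :=
  measurable_fun [set: MB] f /\
  exists K : R, forall M : 'M[R]_n, orthogonal M -> `|f M| <= K.

Definition expec (f : MB -> R) : R := Rintegral mu setT f.

Lemma measurable_entry i j : measurable_fun [set: MB] (fun M : 'M[R]_n => M i j).
Proof.
apply: (measurability _ (measurable_realfun.RGenOpens.measurableE R)) => //.
move=> _ [_ [a [b ->] <-]]; rewrite setTI; apply: sub_sigma_algebra.
have /continuousP h := @coord_continuous R n n i j.
by apply: h; exact: interval_open.
Qed.

Lemma continuous_mulmxl (Q : 'M[R]_n) : continuous (fun M : 'M[R]_n => Q *m M).
Proof.
move=> M B [P hP sPB].
have c i j : continuous (fun N : 'M[R]_n => (Q *m N) i j).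
  have -> : (fun N : 'M[R]_n => (Q *m N) i j) = (fun N => \sum_k Q i k * N k j).
    by apply/funext => N; rewrite mxE.
  apply: continuous_big; first exact: add_continuous.
  by move=> k _ N; apply: (@cvgMl_tmp _ _ (nbhs N)); exact: coord_continuous.
have : \forall N \near M, forall ij : 'I_n * 'I_n, P ij.1 ij.2 ((Q *m N) ij.1 ij.2).
  by apply: (@filter_forall _ _ _ (nbhs M)) => -[i j] /=; exact: (c i j M _ (hP i j)).
by apply: (@filterS _ (nbhs M)) => N hN /=; apply: sPB => i j; exact: (hN (i, j)).
Qed.

Lemma measurable_mull (Q : 'M[R]_n) :
  measurable_fun [set: MB] (fun M : MB => (Q *m (M : 'M[R]_n)) : MB).
Proof.
apply: (measurability _ (erefl (@measurable _ (mxBorel R n)))) => //.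
move=> _ [B oB <-]; rewrite setTI; apply: sub_sigma_algebra.
by move/continuousP: (@continuous_mulmxl Q); apply.
Qed.

Definition Oset : set MB := [set M : 'M[R]_n | orthogonal M].

(** Orthogonality amounts to finitely many scalar equations, each the preimage of a point under a
    polynomial in the entries. *)
Lemma measurable_O : measurable Oset.
Proof.
have -> : Oset = \bigcap_(ij in [set: 'I_n * 'I_n])
   [set M : MB | \sum_k (M : 'M[R]_n) ij.1 k * (M : 'M[R]_n) ij.2 k = (ij.1 == ij.2)%:R].
  apply/seteqP; split => M.
    move=> oM [i j] _ /=.
    move/matrixP: oM => /(_ i j); rewrite !mxE => <-.
    by apply: eq_bigr => k _; rewrite mxE.
  move=> h; apply/matrixP => i j; rewrite !mxE.
  rewrite -[RHS](h (i, j)) //=.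
  by apply: eq_bigr => k _; rewrite mxE.
apply: fin_bigcap_measurable => // -[i j] _ /=.
have m : measurable_fun [set: MB]
    (fun M : 'M[R]_n => \sum_k M i k * M j k).
  apply: measurable_sum => k.
  by apply: measurable_funM; exact: measurable_entry.
by have := m measurableT [set ((i == j)%:R : R)] (measurable_set1 _); rewrite setTI.
Qed.

Lemma mu_O : mu Oset = 1%E. Proof. exact: (proj1 Hmu). Qed.

Lemma mu_OC : mu (~` Oset) = 0%E.
Proof.
by rewrite probability_setC ?mu_O ?subee//; exact: measurable_O.
Qed.

Lemma nice_integrable f : nice f -> mu.-integrable setT (EFin \o f).
Proof.
move=> [mf [K hK]].
apply/integrableP; split; first exact/measurable_EFinP.
rewrite (ge0_negligible_integral (N := ~` Oset)) //.
- rewrite setDE setCK setTI.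
  apply: (@le_lt_trans _ _ (\int[mu]_(x in Oset) (K%:E))%E); last first.
    rewrite integral_cst; last exact: measurable_O.
    by rewrite [X in (_ * X)%E](_ : _ = 1%E) ?mule1 ?ltry //; exact: mu_O.
  apply: ge0_le_integral => //.
    + exact: measurable_O.
    + apply: measurable_funTS; apply: measurableT_comp => //; exact/measurable_EFinP.
- by apply: measurableC; exact: measurable_O.
- apply: measurableT_comp => //; exact/measurable_EFinP.
- exact: mu_OC.
Qed.

Lemma expecE f : nice f -> expec f = Rintegral mu Oset f.
Proof.
move=> nf; rewrite /expec /Rintegral (negligible_integral (N := ~` Oset)) //.
- by rewrite setDE setCK setTI.
- by apply: measurableC; exact: measurable_O.
- exact: nice_integrable.
- exact: mu_OC.
Qed.

(** Comparing on orthogonal [M] only is what allows [M M^T = 1] to be used under the expectation. *)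
Lemma le_expec f g : nice f -> nice g ->
  (forall M, orthogonal M -> f M <= g M) -> expec f <= expec g.
Proof.
move=> nf ng h; rewrite !expecE //; apply: le_Rintegral => //.
- exact: measurable_O.
- apply: (@integrableS _ _ _ _ setT) => //; [exact: measurable_O|exact: nice_integrable].
- apply: (@integrableS _ _ _ _ setT) => //; [exact: measurable_O|exact: nice_integrable].
Qed.

Lemma eq_expec f g : nice f -> nice g ->
  (forall M, orthogonal M -> f M = g M) -> expec f = expec g.
Proof.
move=> nf ng h; apply/eqP; rewrite eq_le !le_expec // => M oM; rewrite h //.
Qed.

Lemma nice_cst c : nice (fun=> c).
Proof. by split; [exact: measurable_cst|exists `|c|]. Qed.

Lemma nice_add f g : nice f -> nice g -> nice (fun M => f M + g M).
Proof.
move=> [mf [K hK]] [mg [L hL]]; split; first exact: measurable_funD.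
exists (K + L) => M oM; rewrite (le_trans (ler_normD _ _))// lerD //; [exact: hK|exact: hL].
Qed.

Lemma nice_mul f g : nice f -> nice g -> nice (fun M => f M * g M).
Proof.
move=> [mf [K hK]] [mg [L hL]]; split; first exact: measurable_funM.
exists (K * L) => M oM; rewrite normrM ler_pM //; [exact: hK|exact: hL].
Qed.

Lemma nice_opp f : nice f -> nice (fun M => - f M).
Proof.
move=> [mf [K hK]]; split; first exact: measurableT_comp.
by exists K => M oM; rewrite normrN; exact: hK.
Qed.

Lemma nice_norm f : nice f -> nice (fun M => `|f M|).
Proof.
move=> [mf [K hK]]; split; first exact: measurableT_comp.
by exists K => M oM; rewrite normr_id; exact: hK.
Qed.

Lemma nice_sum (I : Type) (r : seq I) (F : I -> MB -> R) :
  (forall i, nice (F i)) -> nice (fun M => \sum_(i <- r) F i M).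
Proof.
move=> h; elim: r => [|a r ih].
  by under eq_fun do rewrite big_nil; exact: nice_cst.
by under eq_fun do rewrite big_cons; exact: nice_add.
Qed.

Lemma nice_comp (g : R -> R) f : continuous g -> (exists C, forall x, `|g x| <= C) ->
  nice f -> nice (fun M => g (f M)).
Proof.
move=> cg [C hC] [mf _]; split; last by exists C => M _; exact: hC.
by apply: measurableT_comp => //; exact: continuous_measurable_fun.
Qed.

Lemma nice_entry i j : nice (fun M : 'M[R]_n => M i j).
Proof.
split; first exact: measurable_entry.
exists 1 => M /matrixP/(_ i i); rewrite !mxE eqxx => h.
(* Row [i] has norm one. The bound [1] is displayed as [true%:R] so that [h] can replace it by the
   sum of squares of that row. *)
rewrite -(@ler_pXn2r _ 2) ?nnegrE // expr1n real_normK ?num_real // -[X in _ <= X]/(true%:R).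
rewrite -h (bigD1 j) //= mxE -expr2 lerDl sumr_ge0 // => k _.
by rewrite mxE -expr2 sqr_ge0.
Qed.

Lemma expec_cst c : expec (fun=> c) = c.
Proof. by rewrite /expec Rintegral_cst // [X in fine X](_ : _ = 1%E) ?mulr1 //; exact: probability_setT. Qed.

Lemma expecD f g : nice f -> nice g -> expec (fun M => f M + g M) = expec f + expec g.
Proof. by move=> nf ng; rewrite /expec RintegralD //; exact: nice_integrable. Qed.

Lemma expecZ c f : nice f -> expec (fun M => c * f M) = c * expec f.
Proof. by move=> nf; rewrite /expec RintegralZl //; exact: nice_integrable. Qed.

Lemma expec_sum (I : Type) (r : seq I) (F : I -> MB -> R) :
  (forall i, nice (F i)) -> expec (fun M => \sum_(i <- r) F i M) = \sum_(i <- r) expec (F i).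
Proof.
move=> h; elim: r => [|a r ih].
  by under eq_fun do rewrite big_nil; rewrite expec_cst big_nil.
under eq_fun do rewrite big_cons.
by rewrite expecD ?big_cons ?ih //; exact: nice_sum.
Qed.

Lemma ler_norm_expec f : nice f -> `|expec f| <= expec (fun M => `|f M|).
Proof. by move=> nf; apply: le_normr_Rintegral => //; exact: nice_integrable. Qed.

(** Invariance is given on measurable sets; it passes to functions by identifying the pushforward
    measure with [mu]. *)
Lemma expec_mull (Q : 'M[R]_n) f : orthogonal Q -> nice f ->
  expec (fun M : 'M[R]_n => f (Q *m M)) = expec f.
Proof.
move=> oQ nf; rewrite /expec /Rintegral; congr fine.
have nQ : nice (fun M : 'M[R]_n => f (Q *m M)).
  case: nf => mf [K hK]; split; first exact: (measurableT_comp mf (measurable_mull Q)).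
  exists K => M oM; apply: hK; rewrite /orthogonal trmx_mul mulmxA -(mulmxA Q) oM.
  by rewrite mulmx1.
pose ph := (fun M : MB => (Q *m (M : 'M[R]_n)) : MB).
have mph : measurable_fun [set: MB] ph by exact: measurable_mull.
transitivity (\int[pushforward mu ph]_y (EFin \o f) y)%E.
  rewrite integral_pushforward //.
  - apply/measurable_EFinP; exact: (proj1 nf).
  - exact: nice_integrable nQ.
apply: eq_measure_integral => B mB _.
by rewrite /pushforward; case: (proj2 Hmu Q oQ B mB).
Qed.

End expectation.

(** * Elementary Taylor bounds for sine and cosine *)

Section mean_value.
Variable R : realType.
Implicit Types (f df : R -> R) (x K : R).

(** The derivative is not bounded at [0] itself: the estimate fed in later comes from a division by
    the frequency and holds only away from [0]. The intermediate point of the mean value theorem is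
    never an endpoint. *)
Lemma mvt_bound f df x K : (forall c : R, is_derive c 1 f (df c)) ->
  (forall c, c != 0 -> `|c| <= `|x| -> `|df c| <= K) -> `|f x - f 0| <= K * `|x|.
Proof.
move=> dfP h.
have cf : continuous f.
  by move=> c; apply: differentiable_continuous; apply/derivable1_diffP; exact: (@ex_derive _ _ _ _ _ _ _ (dfP c)).
case: (ltgtP x 0) => [x0|x0|->]; last by rewrite subrr !normr0 mulr0.
- have [c] := MVT x0 (fun c _ => dfP c) (continuous_subspaceT cf).
  rewrite in_itv /= => /andP[xc c0] e.
  rewrite distrC e sub0r normrM normrN ler_wpM2r // h ?lt_eqF //.
  by rewrite !ltr0_norm // lerN2 ltW.
- have [c] := MVT x0 (fun c _ => dfP c) (continuous_subspaceT cf).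
  rewrite in_itv /= => /andP[c0 cx] e.
  rewrite e subr0 normrM ler_wpM2r // h ?gt_eqF //.
  by rewrite !gtr0_norm // ltW.
Qed.

Lemma sin_abs_le x : `|sin x| <= `|x|.
Proof.
have := @mvt_bound sin cos x 1 (fun c => is_derive_sin c) _.
rewrite sin0 subr0 mul1r; apply => c _ _.
by rewrite ler_norml cos_geN1 cos_le1.
Qed.

Lemma cos_sub1_le x : `|cos x - 1| <= x ^+ 2.
Proof.
have := @mvt_bound cos (fun c => - sin c) x `|x| (fun c => is_derive_cos c) _.
rewrite cos0 -expr2 real_normK ?num_real //; apply => c _ cx.
by rewrite normrN (le_trans (sin_abs_le c)).
Qed.

Lemma sin_sub_le x : `|sin x - x| <= `|x| ^+ 3.
Proof.
have d (c : R) : is_derive c 1 (fun y => sin y - y) (cos c - 1).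
  by apply: is_deriveB.
have := @mvt_bound _ _ x (`|x| ^+ 2) d.
rewrite sin0 subr0 subr0 -exprSr; apply => c _ cx.
rewrite (le_trans (cos_sub1_le c)) // -(@real_normK _ c) ?num_real //.
by rewrite ler_pXn2r ?nnegrE.
Qed.

Lemma sin_sub_le2 x : `|sin x - x| <= x ^+ 2.
Proof.
have d (c : R) : is_derive c 1 (fun y => sin y - y) (cos c - 1).
  by apply: is_deriveB.
have h (y : R) : `|cos y - 1| <= `|y|.
  have := @mvt_bound cos (fun c => - sin c) y 1 (fun c => is_derive_cos c) _.
  rewrite cos0 mul1r; apply => c _ _.
  by rewrite normrN ler_norml sin_geN1 sin_le1.
have := @mvt_bound _ _ x `|x| d.
rewrite sin0 subr0 subr0 -expr2 real_normK ?num_real //; apply => c _ cx.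
by rewrite (le_trans (h c)).
Qed.

Lemma cos_taylor2 x : `|cos x - 1 + x ^+ 2 / 2| <= `|x| ^+ 3.
Proof.
have d (c : R) : is_derive c 1 (fun y => cos y - 1 + y ^+ 2 / 2) (- (sin c - c)).
  have -> : (fun y : R => cos y - 1 + y ^+ 2 / 2) = cos - cst 1 + 2^-1 \*: (id ^+ 2).
    by apply/funext => y; rewrite mulrC.
  apply: is_derive_eq; rewrite /GRing.scale /= expr1 mulr1 mulrA mulVf ?pnatr_eq0 //.
  by rewrite mul1r subr0 opprB addrC.
have := @mvt_bound _ _ x (`|x| ^+ 2) d.
rewrite cos0 subrr expr0n /= mul0r addr0 subr0 -exprSr; apply => c _ cx.
rewrite normrN (le_trans (sin_sub_le2 c)) // -(@real_normK _ c) ?num_real //.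
by rewrite ler_pXn2r ?nnegrE.
Qed.

End mean_value.

(** * Second-order expansions uniform on the orthogonal group *)

Section jets.
Variables (R : realType) (n : nat).
Local Notation MB := (mxBorel R n).

(** No measurability is asked of a remainder: it is never integrated, only bounded pointwise. *)
Definition ubnd (r : R -> MB -> R) := exists K : R,
  forall e (M : 'M[R]_n), `|e| <= 1 -> orthogonal M -> `|r e M| <= K.

(** A uniform expansion at [e = 0], where [F2] is half the second derivative. Such expansions are
    stable under sums, products and cosine by plain algebra, which replaces differential calculus on
    the group. *)
Definition jet (F : R -> MB -> R) (F0 F1 F2 : MB -> R) :=
  [/\ nice F0, nice F1, nice F2 & exists2 r, ubnd r &
    forall e (M : 'M[R]_n), `|e| <= 1 -> orthogonal M ->
      F e M = F0 M + e * F1 M + e ^+ 2 * F2 M + e ^+ 3 * r e M].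

Lemma ubnd_cst f : nice f -> ubnd (fun _ => f).
Proof. by move=> [_ [K hK]]; exists K => e M _; exact: hK. Qed.

Lemma ubnd_id : ubnd (fun e _ => e).
Proof. by exists 1. Qed.

Lemma ubnd_add r s : ubnd r -> ubnd s -> ubnd (fun e M => r e M + s e M).
Proof.
move=> [K hK] [L hL]; exists (K + L) => e M he oM.
by rewrite (le_trans (ler_normD _ _)) // lerD ?hK ?hL.
Qed.

Lemma ubnd_mul r s : ubnd r -> ubnd s -> ubnd (fun e M => r e M * s e M).
Proof.
move=> [K hK] [L hL]; exists (K * L) => e M he oM.
by rewrite normrM ler_pM ?hK ?hL.
Qed.

Lemma jet_eq F F0 F1 F2 G0 G1 G2 : jet F F0 F1 F2 ->
  F0 =1 G0 -> F1 =1 G1 -> F2 =1 G2 -> jet F G0 G1 G2.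
Proof. by move=> h /funext <- /funext <- /funext <-. Qed.

Lemma jet_cst f : nice f -> jet (fun _ => f) f (fun=> 0) (fun=> 0).
Proof.
move=> nf; split=> //; try exact: nice_cst.
exists (fun _ _ => 0); first exact/ubnd_cst/nice_cst.
by move=> e M _ _; rewrite !mulr0 !addr0.
Qed.

Lemma jet_add F F0 F1 F2 G G0 G1 G2 : jet F F0 F1 F2 -> jet G G0 G1 G2 ->
  jet (fun e M => F e M + G e M) (fun M => F0 M + G0 M) (fun M => F1 M + G1 M)
      (fun M => F2 M + G2 M).
Proof.
move=> [? ? ? [r br hr]] [? ? ? [s bs hs]]; split; try exact: nice_add.
exists (fun e M => r e M + s e M); first exact: ubnd_add.
move=> e M he oM; rewrite hr // hs //; ring.
Qed.

Lemma jet_mul F F0 F1 F2 G G0 G1 G2 : jet F F0 F1 F2 -> jet G G0 G1 G2 ->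
  jet (fun e M => F e M * G e M) (fun M => F0 M * G0 M)
      (fun M => F0 M * G1 M + F1 M * G0 M)
      (fun M => F0 M * G2 M + F1 M * G1 M + F2 M * G0 M).
Proof.
move=> [n0 n1 n2 [r br hr]] [m0 m1 m2 [s bs hs]].
split; do ?[exact: nice_mul|apply: nice_add].
exists (fun e M => F0 M * s e M + F1 M * G2 M + F2 M * G1 M + r e M * G0 M
  + e * (F1 M * s e M + F2 M * G2 M + r e M * G1 M)
  + e * e * (F2 M * s e M + r e M * G2 M) + e * e * e * (r e M * s e M)).
  by do ![exact: ubnd_id|exact: ubnd_cst|apply: ubnd_add|apply: ubnd_mul|done].
move=> e M he oM; rewrite hr // hs //; ring.
Qed.

Lemma jet_sum (I : Type) (q : seq I) (F : I -> R -> MB -> R) (F0 F1 F2 : I -> MB -> R) :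
  (forall i, jet (F i) (F0 i) (F1 i) (F2 i)) ->
  jet (fun e M => \sum_(i <- q) F i e M) (fun M => \sum_(i <- q) F0 i M)
      (fun M => \sum_(i <- q) F1 i M) (fun M => \sum_(i <- q) F2 i M).
Proof.
move=> h; elim: q => [|a q ih].
  have -> : (fun (e : R) (M : MB) => \sum_(i <- [::]) F i e M) = (fun _ _ => 0).
    by apply/funext => e; apply/funext => M; rewrite big_nil.
  by apply: (jet_eq (jet_cst (@nice_cst R n 0))) => M; rewrite big_nil.
have -> : (fun (e : R) (M : MB) => \sum_(i <- a :: q) F i e M) =
    (fun e M => F a e M + \sum_(i <- q) F i e M).
  by apply/funext => e; apply/funext => M; rewrite big_cons.
by apply: (jet_eq (jet_add (h a) ih)) => M; rewrite big_cons.
Qed.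

Lemma continuous_bounded_cos : continuous (@cos R) /\ exists C : R, forall x, `|cos x| <= C.
Proof. by split; [exact: continuous_cos|exists 1 => x; rewrite ler_norml cos_geN1 cos_le1]. Qed.

Lemma continuous_bounded_sin : continuous (@sin R) /\ exists C : R, forall x, `|sin x| <= C.
Proof. by split; [exact: continuous_sin|exists 1 => x; rewrite ler_norml sin_geN1 sin_le1]. Qed.

Lemma nice_cos (f : MB -> R) : nice f -> nice (fun M => cos (f M)).
Proof. by have [c b] := continuous_bounded_cos; exact: nice_comp. Qed.

Lemma nice_sin (f : MB -> R) : nice f -> nice (fun M => sin (f M)).
Proof. by have [c b] := continuous_bounded_sin; exact: nice_comp. Qed.

Lemma jet_cos F F0 F1 F2 : jet F F0 F1 F2 ->
  jet (fun e M => cos (F e M)) (fun M => cos (F0 M)) (fun M => - sin (F0 M) * F1 M)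
      (fun M => - sin (F0 M) * F2 M - 2^-1 * (cos (F0 M) * (F1 M * F1 M))).
Proof.
move=> [n0 n1 n2 [r br hr]].
have nc := nice_cos n0; have ns := nice_sin n0.
split => //.
- by apply: nice_mul => //; exact: nice_opp.
- apply: nice_add; first by apply: nice_mul => //; exact: nice_opp.
  apply: nice_opp; apply: nice_mul; first exact: nice_cst.
  by do 2 apply: nice_mul => //.
pose k e M := F1 M + e * F2 M + e * e * r e M.
have bk : ubnd k.
  by do ![exact: ubnd_id|exact: ubnd_cst|apply: ubnd_add|apply: ubnd_mul|done].
(* Normalised cubic remainders. At [h = 0] the inverse is [0] by convention, so [e1] and [e2] hold
   there too. *)
pose p1 (h : R) := (cos h - 1 + h ^+ 2 / 2) / h ^+ 3.
pose p2 (h : R) := (sin h - h) / h ^+ 3.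
have b1 h : `|p1 h| <= 1.
  rewrite /p1 normrM normfV normrX; have [->|h0] := eqVneq h 0.
    by rewrite normr0 !expr0n /= invr0 mulr0.
  by rewrite ler_pdivrMr ?mul1r ?cos_taylor2 // exprn_gt0 // normr_gt0.
have b2 h : `|p2 h| <= 1.
  rewrite /p2 normrM normfV normrX; have [->|h0] := eqVneq h 0.
    by rewrite normr0 !expr0n /= invr0 mulr0.
  by rewrite ler_pdivrMr ?mul1r ?sin_sub_le // exprn_gt0 // normr_gt0.
have e1 h : cos h = 1 - 2^-1 * h ^+ 2 + h ^+ 3 * p1 h.
  rewrite /p1; have [->|h0] := eqVneq h 0; first by rewrite cos0 !expr0n /=; ring.
  by field.
have e2 h : sin h = h + h ^+ 3 * p2 h.
  rewrite /p2; have [->|h0] := eqVneq h 0; first by rewrite sin0 !expr0n /=; ring.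
  by field.
have u1 : ubnd (fun e M => p1 (e * k e M)) by exists 1 => e M _ _.
have u2 : ubnd (fun e M => p2 (e * k e M)) by exists 1 => e M _ _.
(* Since [k = F1 + e l], the difference [k^2 - F1^2] is a multiple of [e], which moves it into the
   cubic remainder. *)
pose l e M := F2 M + e * r e M.
have bl : ubnd l.
  by do ![exact: ubnd_id|exact: ubnd_cst|apply: ubnd_add|apply: ubnd_mul|done].
exists (fun e M => (- 2^-1) * cos (F0 M) * (2 * (F1 M * l e M) + e * (l e M * l e M))
   + cos (F0 M) * (k e M * k e M * k e M) * p1 (e * k e M)
   + (- 1) * sin (F0 M) * (r e M + k e M * k e M * k e M * p2 (e * k e M))).
  have nC c := ubnd_cst (nice_cst n c).
  by do ![exact: u1|exact: u2|exact: bk|exact: bl|exact: nC|exact: ubnd_id|exact: ubnd_cst|apply: ubnd_add|apply: ubnd_mul|done].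
move=> e M he oM; rewrite hr //.
have -> : F0 M + e * F1 M + e ^+ 2 * F2 M + e ^+ 3 * r e M = F0 M + e * k e M.
  by rewrite /k; ring.
rewrite cosD (e1 (e * k e M)) (e2 (e * k e M)).
set q1 := p1 _; set q2 := p2 _; rewrite /l /k; by field.
Qed.

Definition mjet (F : R -> MB -> 'M[R]_n) (F0 F1 F2 : MB -> 'M[R]_n) :=
  forall i j, jet (fun e M => F e M i j) (fun M => F0 M i j) (fun M => F1 M i j)
                  (fun M => F2 M i j).

Definition mnice (f : MB -> 'M[R]_n) := forall i j, nice (fun M => f M i j).

Lemma mjet_eq F F0 F1 F2 G0 G1 G2 : mjet F F0 F1 F2 ->
  F0 =1 G0 -> F1 =1 G1 -> F2 =1 G2 -> mjet F G0 G1 G2.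
Proof. by move=> h /funext <- /funext <- /funext <-. Qed.

Lemma mjet_cst f : mnice f -> mjet (fun _ => f) f (fun=> 0) (fun=> 0).
Proof. by move=> nf i j; apply: (jet_eq (jet_cst (nf i j))) => M //; rewrite mxE. Qed.

Lemma mjet_mul F F0 F1 F2 G G0 G1 G2 : mjet F F0 F1 F2 -> mjet G G0 G1 G2 ->
  mjet (fun e M => F e M *m G e M) (fun M => F0 M *m G0 M)
      (fun M => F0 M *m G1 M + F1 M *m G0 M)
      (fun M => F0 M *m G2 M + F1 M *m G1 M + F2 M *m G0 M).
Proof.
move=> h h' i j.
have -> : (fun e M => (F e M *m G e M) i j) = (fun e M => \sum_k F e M i k * G e M k j).
  by apply/funext => e; apply/funext => M; rewrite mxE.
apply: (jet_eq (jet_sum _ (fun k => jet_mul (h i k) (h' k j)))) => M;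
  by rewrite !mxE -?big_split.
Qed.

Lemma jet_trace F F0 F1 F2 : mjet F F0 F1 F2 ->
  jet (fun e M => \tr (F e M)) (fun M => \tr (F0 M)) (fun M => \tr (F1 M))
      (fun M => \tr (F2 M)).
Proof. by move=> h; apply: jet_sum. Qed.

Lemma mnice_cst B : mnice (fun=> B).
Proof. by move=> i j; exact: nice_cst. Qed.

Lemma mnice_id : mnice (fun M => M).
Proof. exact: nice_entry. Qed.

Lemma mnice_tr (f : MB -> _) : mnice f -> mnice (fun M => (f M)^T).
Proof. by move=> h i j; under eq_fun do rewrite mxE; exact: h. Qed.

Lemma mnice_mul (f g : MB -> _) : mnice f -> mnice g -> mnice (fun M => f M *m g M).
Proof.
move=> h h' i j; under eq_fun do rewrite mxE.
by apply: nice_sum => k; exact: nice_mul.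
Qed.

Lemma nice_trace (f : MB -> _) : mnice f -> nice (fun M => \tr (f M)).
Proof. by move=> h; apply: nice_sum. Qed.

End jets.

(** * Frobenius norm and trace inequalities *)

Section frobenius.
Variables (R : realType) (n : nat).
Implicit Types B C K Q : 'M[R]_n.

(** The square of the Frobenius norm, kept squared to stay polynomial in the entries. *)
Definition nrm B : R := \sum_i \sum_j B i j ^+ 2.

Lemma nrm_ge0 B : 0 <= nrm B.
Proof. by apply: sumr_ge0 => i _; apply: sumr_ge0 => j _; exact: sqr_ge0. Qed.

Lemma mxtrace_mul_entries B C : \tr (B *m C) = \sum_i \sum_j B i j * C j i.
Proof. by apply: eq_bigr => i _; rewrite mxE. Qed.

Lemma nrm_trmx B : nrm B^T = nrm B.
Proof.
rewrite /nrm exchange_big /=; apply: eq_bigr => i _; apply: eq_bigr => j _.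
by rewrite mxE.
Qed.

Lemma nrmE B : nrm B = \tr (B^T *m B).
Proof.
rewrite mxtrace_mul_entries -nrm_trmx; apply: eq_bigr => i _; apply: eq_bigr => j _.
by rewrite mxE.
Qed.

Lemma orthogonal_trmx Q : orthogonal Q -> orthogonal Q^T.
Proof. by rewrite /orthogonal trmxK => /mulmx1C. Qed.

Lemma orthogonalM Q Q' : orthogonal Q -> orthogonal Q' -> orthogonal (Q *m Q').
Proof.
rewrite /orthogonal => h h'; rewrite trmx_mul mulmxA -(mulmxA Q) h'.
by rewrite mulmx1.
Qed.

Lemma nrm_mul_orthl Q B : orthogonal Q -> nrm (Q *m B) = nrm B.
Proof.
move=> /orthogonal_trmx; rewrite /orthogonal trmxK => h.
by rewrite !nrmE trmx_mul mulmxA -(mulmxA B^T) h mulmx1.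
Qed.

Lemma nrm_mul_orthr Q B : orthogonal Q -> nrm (B *m Q) = nrm B.
Proof.
by move=> h; rewrite -nrm_trmx trmx_mul nrm_mul_orthl ?nrm_trmx //; exact: orthogonal_trmx.
Qed.

Lemma nrm_add B C : nrm (B + C) <= 2 * nrm B + 2 * nrm C.
Proof.
rewrite /nrm !mulr_sumr -big_split /=; apply: ler_sum => i _.
rewrite !mulr_sumr -big_split /=; apply: ler_sum => j _; rewrite mxE.
have := sqr_ge0 (B i j - C i j); nra.
Qed.

Lemma nrm_opp B : nrm (- B) = nrm B.
Proof. by apply: eq_bigr => i _; apply: eq_bigr => j _; rewrite mxE sqrrN. Qed.

Lemma nrm_sub B C : nrm (B - C) <= 2 * nrm B + 2 * nrm C.
Proof. by rewrite -(nrm_opp C) nrm_add. Qed.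

Lemma mxtrace_mul_le B C : `|\tr (B *m C)| <= 2^-1 * (nrm B + nrm C).
Proof.
rewrite mxtrace_mul_entries -(nrm_trmx C) /nrm -big_split /= mulr_sumr.
apply: (le_trans (ler_norm_sum _ _ _)); apply: ler_sum => i _.
rewrite -big_split /= mulr_sumr; apply: (le_trans (ler_norm_sum _ _ _)); apply: ler_sum => j _.
rewrite mxE ler_norml; apply/andP; split.
  have := sqr_ge0 (B i j + C j i); nra.
have := sqr_ge0 (B i j - C j i); nra.
Qed.

(** By Lagrange's identity, the gap is half the sum of the squares of the minors
    [x k * y l - x l * y k]. *)
Lemma cauchy_schwarz_sum (m : nat) (x y : 'I_m -> R) :
  (\sum_k x k * y k) ^+ 2 <= (\sum_k x k ^+ 2) * (\sum_k y k ^+ 2).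
Proof.
rewrite -subr_ge0.
suff -> : (\sum_k x k ^+ 2) * (\sum_k y k ^+ 2) - (\sum_k x k * y k) ^+ 2 =
    2^-1 * \sum_k \sum_l (x k * y l - x l * y k) ^+ 2.
  rewrite mulr_ge0 // sumr_ge0 // => k _; apply: sumr_ge0 => l _; exact: sqr_ge0.
have -> : \sum_k \sum_l (x k * y l - x l * y k) ^+ 2 =
   \sum_k \sum_l (x k ^+ 2 * y l ^+ 2) + \sum_k \sum_l (x l ^+ 2 * y k ^+ 2)
    + (- 2) * \sum_k \sum_l (x k * y k * (x l * y l)).
  rewrite mulr_sumr -!big_split /=; apply: eq_bigr => k _.
  rewrite mulr_sumr -!big_split /=; apply: eq_bigr => l _; ring.
have s (u v : 'I_m -> R) : \sum_k \sum_l (u k * v l) = (\sum_k u k) * (\sum_k v k).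
  by rewrite mulr_suml; apply: eq_bigr => k _; rewrite mulr_sumr.
rewrite (s (fun k => x k ^+ 2) (fun k => y k ^+ 2)) (s (fun k => x k * y k) (fun k => x k * y k)).
rewrite [X in _ + X + _]exchange_big /= (s (fun k => x k ^+ 2) (fun k => y k ^+ 2)).
by field.
Qed.

Lemma nrm_mul B C : nrm (B *m C) <= nrm B * nrm C.
Proof.
rewrite -(nrm_trmx C) /nrm mulr_suml; apply: ler_sum => i _.
rewrite mulr_sumr; apply: ler_sum => j _.
rewrite mxE (le_trans (cauchy_schwarz_sum _ _)) // ler_wpM2l //.
  by apply: sumr_ge0 => k _; exact: sqr_ge0.
by rewrite le_eqVlt; apply/orP; left; apply/eqP; apply: eq_bigr => k _; rewrite mxE.
Qed.

End frobenius.

(** * Plane rotations and sums over all coordinate planes *)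

Section rotations.
Variables (R : realType) (n : nat).
Implicit Types (X B C K Q : 'M[R]_n) (e : R).

(** The infinitesimal rotation of a coordinate plane. Sums run over all ordered pairs: [i = j]
    contributes zero and each plane counts twice, whence the factors [2] below. *)
Definition skew (i j : 'I_n) : 'M[R]_n := delta_mx i j - delta_mx j i.

Lemma skew_trmx i j : (skew i j)^T = - skew i j.
Proof. by rewrite /skew linearB /= !trmx_delta opprB. Qed.

Lemma skew3 i j : skew i j *m (skew i j *m skew i j) = - skew i j.
Proof.
rewrite /skew; have [->|ij] := eqVneq i j; first by rewrite subrr !mul0mx oppr0.
have ji : (j == i) = false by rewrite eq_sym (negbTE ij).
rewrite !(mulmxBl, mulmxBr) !mul_delta_mx_cond !eqxx !(negbTE ij) !ji.
rewrite !(mulr0n, mulr1n, mulmx0, mul0mx) !mul_delta_mx_cond !eqxx !(negbTE ij) !ji.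
by rewrite !(mulr0n, mulr1n, subr0, sub0r, oppr0, opprK, mulmxN, mul_delta_mx_cond, eqxx) //= opprB addrC.
Qed.

(* Cayley transform: the coefficients satisfy [a^2 + b^2 = 2 b], which together with
   [X^3 = - X] makes the matrix orthogonal without any trigonometry. *)
Definition rot X e : 'M[R]_n :=
  1%:M + (4 * e / (4 + e ^+ 2)) *: X + (2 * e ^+ 2 / (4 + e ^+ 2)) *: (X *m X).

Lemma rot_den e : 4 + e ^+ 2 != 0.
Proof. by rewrite gt_eqF //; have := sqr_ge0 e; lra. Qed.

Lemma rot_trmx X e : X^T = - X ->
  (rot X e)^T = 1%:M - (4 * e / (4 + e ^+ 2)) *: X + (2 * e ^+ 2 / (4 + e ^+ 2)) *: (X *m X).
Proof.
by move=> h; rewrite /rot !linearD /= !linearZ /= trmx1 trmx_mul h mulNmx mulmxN opprK scalerN.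
Qed.

Lemma rot_orthogonal X e : X^T = - X -> X *m (X *m X) = - X -> orthogonal (rot X e).
Proof.
move=> hT h3; rewrite /orthogonal rot_trmx // /rot.
have d0 := rot_den e.
move eY : (X *m X) h3 => Y h3.
have hYX : Y *m X = - X by rewrite -eY -mulmxA eY.
have hYY : Y *m Y = - Y by rewrite -{2}eY mulmxA hYX mulNmx eY.
rewrite !(mulmxDl, mulmxDr, mul1mx, mulmx1, mulmxN, mulNmx) -!scalemxAl -!scalemxAr.
rewrite eY h3 hYX hYY; apply/matrixP => i j; rewrite !mxE.
by field.
Qed.

(** Agreement with [exp (e X)] to second order: the coefficients are [e - e^3 / (4 + e^2)] and
    [e^2 / 2 - e^4 / (2 (4 + e^2))], which gives the remainder exhibited. *)
Lemma mjet_rot X : mjet (fun e _ => rot X e) (fun=> 1%:M) (fun=> X) (fun=> 2^-1 *: (X *m X)).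
Proof.
move=> i j; split; try exact: nice_cst.
exists (fun e M => (- (4 + e ^+ 2)^-1) * (X i j + e * (2^-1 * (X *m X) i j))).
  apply: ubnd_mul.
    exists 1 => e M _ _; rewrite normrN normfV invf_le1 ger0_norm; have := sqr_ge0 e; lra.
  apply: ubnd_add; first exact/ubnd_cst/nice_cst.
  by apply: ubnd_mul; [exact: ubnd_id|exact/ubnd_cst/nice_cst].
move=> e M _ _; have d0 := rot_den e.
rewrite /rot !mxE; set Y := \sum_k _; by field.
Qed.

Lemma mjet_rot_trmx X : X^T = - X ->
  mjet (fun e _ => (rot X e)^T) (fun=> 1%:M) (fun=> - X) (fun=> 2^-1 *: (X *m X)).
Proof.
move=> hT i j.
have -> : (fun (e : R) (M : mxBorel R n) => (rot X e)^T i j) = (fun e _ => rot (- X) e i j).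
  apply/funext => e; apply/funext => M.
  by rewrite rot_trmx // /rot mulNmx mulmxN opprK scalerN.
by apply: (jet_eq (mjet_rot (- X) i j)) => M //; rewrite mulNmx mulmxN opprK.
Qed.

(** For [Q = P] this is [H]; replacing [M] by [R M] turns it into [R H R^T]. *)
Definition conjO Q (M : 'M[R]_n) : 'M[R]_n := M *m Q *m M^T.

Definition lie X K := X *m K - K *m X.
(** Half the double commutator [[X, [X, K]]]. *)
Definition lie2 X K := 2^-1 *: (X *m X *m K) - X *m K *m X + 2^-1 *: (K *m (X *m X)).

Lemma mnice_conjO Q : mnice (conjO Q).
Proof.
apply: mnice_mul; last exact/mnice_tr/mnice_id.
by apply: mnice_mul; [exact: mnice_id|exact: mnice_cst].
Qed.

Lemma mjet_conjO X Q : X^T = - X ->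
  mjet (fun e M => conjO Q (rot X e *m M)) (conjO Q) (fun M => lie X (conjO Q M))
    (fun M => lie2 X (conjO Q M)).
Proof.
move=> hT.
have -> : (fun (e : R) (M : mxBorel R n) => conjO Q (rot X e *m M)) =
   (fun e M => (rot X e *m conjO Q M) *m (rot X e)^T).
  by apply/funext => e; apply/funext => M; rewrite /conjO trmx_mul !mulmxA.
apply: (mjet_eq (mjet_mul (mjet_mul (mjet_rot X) (mjet_cst (@mnice_conjO Q))) (mjet_rot_trmx hT))) => M.
- by rewrite mul1mx mulmx1.
- by rewrite mul1mx mulmx1 mulmx0 add0r mulmxN addrC.
- rewrite /lie2 !mulmx0 !add0r mul1mx mulmx1 mulmxN -scalemxAl -scalemxAr !mulmxA.
  by rewrite addrC addrA addrAC.
Qed.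

Lemma conjO_orthogonal Q M : orthogonal Q -> orthogonal M -> orthogonal (conjO Q M).
Proof.
by move=> oQ oM; do 2?apply: orthogonalM => //; exact: orthogonal_trmx.
Qed.

Lemma mul_delta_delta K i j k l :
  delta_mx i j *m K *m delta_mx k l = K j k *: delta_mx i l :> 'M[R]_n.
Proof.
apply/matrixP => p q; rewrite !mxE (bigD1 k) //= big1 ?addr0; last first.
  by move=> r rk; rewrite !mxE (negbTE rk) mulr0.
rewrite !mxE eqxx (bigD1 j) //= big1 ?addr0; last first.
  by move=> r rk; rewrite !mxE (negbTE rk) andbF mul0r.
by rewrite !mxE eqxx andbT; case: (p == i); case: (q == l); rewrite /= ?mulr0 ?mulr1 ?mul0r ?mul1r.
Qed.

Lemma sum_skew K : \sum_i \sum_j skew i j *m K *m skew i j = 2 *: (K^T - (\tr K)%:M).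
Proof.
transitivity (\sum_i \sum_j ((K j i *: delta_mx i j + K i j *: delta_mx j i)
  - (K j j *: delta_mx i i + K i i *: delta_mx j j)) : 'M[R]_n).
  apply: eq_bigr => i _; apply: eq_bigr => j _.
  rewrite /skew !(mulmxBl, mulmxBr) !mul_delta_delta.
  by apply/matrixP => p q; rewrite !mxE; ring.
have e1 : \sum_i \sum_j K j i *: delta_mx i j = K^T :> 'M[R]_n.
  rewrite [RHS]matrix_sum_delta; apply: eq_bigr => i _; apply: eq_bigr => j _.
  by rewrite mxE.
have e2 : \sum_i \sum_j K j j *: delta_mx i i = (\tr K)%:M :> 'M[R]_n.
  rewrite -scalemx1 (matrix_sum_delta 1%:M) scaler_sumr; apply: eq_bigr => i _.
  rewrite -scaler_suml -/(\tr K); congr (_ *: _).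
  rewrite (bigD1 i) //= big1 ?addr0 ?mxE ?eqxx ?scale1r // => j ji.
  by rewrite mxE eq_sym (negbTE ji) scale0r.
under eq_bigr do rewrite sumrB !big_split /=.
rewrite sumrB !big_split /= e1 e2.
rewrite [X in _ + X - _]exchange_big /= e1 [X in _ - (_ + X)]exchange_big /= e2.
by apply/matrixP => p q; rewrite !mxE; ring.
Qed.

Lemma sum_skew_sq : \sum_i \sum_j skew i j *m skew i j = (2 - 2 * n%:R)%:M :> 'M[R]_n.
Proof.
have := sum_skew 1%:M; under eq_bigr do under eq_bigr do rewrite mulmx1.
move=> ->; rewrite trmx1 mxtrace1 -raddfB /= scale_scalar_mx.
by congr (_%:M); ring.
Qed.

(** The Casimir operator of the rotation algebra acting by conjugation: [K] is an eigenvector of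
    eigenvalue [- 2 (n - 1)], up to its transpose and a scalar matrix. The scalar part disappears
    when paired with a traceless matrix. *)
Lemma sum_lie2 K : \sum_i \sum_j lie2 (skew i j) K =
  (- (2 * (n%:R - 1))) *: K - 2 *: K^T + (2 * \tr K)%:M.
Proof.
rewrite /lie2; under eq_bigr do rewrite big_split sumrB /= -!scaler_sumr -mulmx_suml -mulmx_sumr.
rewrite big_split sumrB /= -!scaler_sumr -mulmx_suml -mulmx_sumr sum_skew sum_skew_sq.
rewrite mul_scalar_mx mul_mx_scalar; apply/matrixP => p q; rewrite !mxE -mulrnAr; by field.
Qed.

Lemma trace_delta_mul i j C : \tr (delta_mx i j *m C) = C j i.
Proof.
rewrite mxtrace_mul_entries (bigD1 i) //= [X in _ + X]big1 ?addr0; last first.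
  by move=> p pi; rewrite big1 // => q _; rewrite mxE (negbTE pi) mul0r.
rewrite (bigD1 j) //= big1 ?addr0 ?mxE ?eqxx ?mul1r // => q qj.
by rewrite mxE (negbTE qj) andbF mul0r.
Qed.

Lemma trace_skew i j C : \tr (skew i j *m C) = C j i - C i j.
Proof. by rewrite /skew mulmxBl linearB /= !trace_delta_mul. Qed.

Lemma sum_trace_skew_sq C :
  \sum_i \sum_j \tr (skew i j *m C) ^+ 2 = 2 * nrm C - 2 * \tr (C *m C).
Proof.
under eq_bigr do under eq_bigr do rewrite trace_skew sqrrB.
under eq_bigr do rewrite big_split sumrB /=.
rewrite big_split sumrB /= [X in X - _ + _]exchange_big /= -/(nrm C).
rewrite mxtrace_mul_entries.
have -> : \sum_i \sum_j (C j i * C i j *+ 2) = 2 * \sum_i \sum_j C i j * C j i.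
  rewrite mulr_sumr; apply: eq_bigr => i _; rewrite mulr_sumr; apply: eq_bigr => j _.
  by rewrite mulr_natl mulrC.
by ring.
Qed.

Lemma sum_trace_skew_sq_le C : \sum_i \sum_j \tr (skew i j *m C) ^+ 2 <= 4 * nrm C.
Proof.
rewrite sum_trace_skew_sq; have := mxtrace_mul_le C C.
by rewrite ler_norml => /andP[]; lra.
Qed.

Lemma sum_trace_skew2 B K :
  \sum_i \sum_j \tr (B *m skew i j *m K *m skew i j) =
  2 * \tr (B *m K^T) - 2 * \tr B * \tr K.
Proof.
transitivity (\tr (B *m \sum_i \sum_j skew i j *m K *m skew i j)).
  rewrite mulmx_sumr raddf_sum; apply: eq_bigr => i _.
  rewrite mulmx_sumr raddf_sum; apply: eq_bigr => j _.
  by rewrite !mulmxA.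
rewrite sum_skew -scalemxAr mxtraceZ mulmxBr linearB /= mul_mx_scalar mxtraceZ.
by ring.
Qed.

End rotations.

Lemma nice_sqr (R : realType) (n : nat) (f : mxBorel R n -> R) :
  nice f -> nice (fun M => f M ^+ 2).
Proof. by move=> h; under eq_fun do rewrite expr2; exact: nice_mul. Qed.

Ltac nice_tac := repeat first
  [ assumption
  | match goal with H : forall i j, nice _ |- _ => exact: H end
  | exact: nice_cst | exact: mnice_cst | exact: mnice_conjO | exact: mnice_id
  | apply: nice_sqr | apply: nice_add | apply: nice_opp | apply: nice_mul | apply: nice_norm
  | apply: nice_cos | apply: nice_sin
  | (apply: nice_sum; move=> ?)
  | apply: nice_trace | apply: mnice_mul | apply: mnice_tr].

(** * Integration by parts on the orthogonal group *)

Section haar_moments.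
Variables (R : realType) (n : nat) (mu : probability (mxBorel R n) R).
Hypothesis Hmu : is_Haar_On mu.
Local Notation MB := (mxBorel R n).
Local Notation E := (expec mu).

Lemma nice_mull (Q : 'M[R]_n) (f : MB -> R) : orthogonal Q -> nice f ->
  nice (fun M : 'M[R]_n => f (Q *m M)).
Proof.
move=> oQ [mf [K hK]]; split; first exact: (measurableT_comp mf (measurable_mull Q)).
by exists K => M oM; apply: hK; exact: orthogonalM.
Qed.

(* Adding the expansions at [e] and [-e] cancels the first-order term, so the invariant
   expectation forces [2 e^2 E F2 = O(e^3)]. *)
Lemma expec_jet2_eq0 (X : 'M[R]_n) f F1 F2 : X^T = - X -> X *m (X *m X) = - X ->
  jet (fun e M => f (rot X e *m M)) f F1 F2 -> E F2 = 0.
Proof.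
move=> hT h3 [n0 n1 n2 [r [K hK] hr]].
have inv e : E (fun M => f (rot X e *m M)) = E f.
  by apply: expec_mull => //; exact: rot_orthogonal.
have bound e : `|e| <= 1 -> `|e * E F1 + e ^+ 2 * E F2| <= K * `|e| ^+ 3.
  move=> he.
  have nR : nice (fun M => f (rot X e *m M)).
    by apply: nice_mull => //; exact: rot_orthogonal.
  have -> : e * E F1 + e ^+ 2 * E F2 =
      - E (fun M => f (rot X e *m M) + (- 1) * f M + (- e) * F1 M + (- e ^+ 2) * F2 M).
    by rewrite !expecD ?expecZ ?inv //; nice_tac; ring.
  rewrite normrN (le_trans (ler_norm_expec Hmu _)) //; first by nice_tac.
  rewrite -[X in _ <= X](expec_cst mu); apply: le_expec => //; [by nice_tac|by nice_tac|].
  move=> M oM; rewrite hr //.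
  have -> : f M + e * F1 M + e ^+ 2 * F2 M + e ^+ 3 * r e M + -1 * f M + - e * F1 M +
     - e ^+ 2 * F2 M = e ^+ 3 * r e M by ring.
  by rewrite normrM normrX mulrC ler_wpM2r ?exprn_ge0 // hK.
apply/eqP; rewrite -normr_le0; apply/ler_addgt0Pr => d d0; rewrite add0r.
(* The bounds at [e] and [- e] give [|E F2| <= e K], and this [e] makes the right-hand side at most
   [d]. *)
pose e := Num.min 1 (d / (`|K| + 1)).
have K1 : 0 < `|K| + 1 by rewrite ltr_wpDl.
have e0 : 0 < e by rewrite lt_min ltr01 divr_gt0.
have e1 : e <= 1 by rewrite ge_min lexx.
have ed : e * (`|K| + 1) <= d by rewrite -ler_pdivlMr // ge_min lexx orbT.
have := bound e; rewrite ger0_norm ?(ltW e0) // => /(_ e1) b1.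
have := bound (- e); rewrite normrN ger0_norm ?(ltW e0) // => /(_ e1) b2.
have h : 2 * e ^+ 2 * `|E F2| <= 2 * (K * e ^+ 3).
  have -> : 2 * e ^+ 2 * `|E F2| = `|(e * E F1 + e ^+ 2 * E F2) + (- e * E F1 + (- e) ^+ 2 * E F2)|.
    have -> : (e * E F1 + e ^+ 2 * E F2) + (- e * E F1 + (- e) ^+ 2 * E F2) = 2 * e ^+ 2 * E F2 by ring.
    by rewrite normrM [`|2 * _|]ger0_norm // mulr_ge0 // sqr_ge0.
  by rewrite (le_trans (ler_normD _ _)) // mulr_natl mulr2n lerD.
have e2 : 0 < 2 * e ^+ 2 by rewrite mulr_gt0 // exprn_gt0.
rewrite -(ler_pM2l e2) (le_trans h) //.
have -> : 2 * (K * e ^+ 3) = 2 * e ^+ 2 * (e * K) by ring.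
rewrite ler_pM2l // (le_trans _ ed) // ler_pM2l //.
by rewrite (le_trans (ler_norm K)) // lerDl.
Qed.

(** Since each plane counts twice and [F2] is half a second derivative, the double sum of [F2] is
    the Laplacian of [f], and that of [F1^2] is twice its squared gradient. *)
Definition ljet (f : MB -> R) (F1 F2 : 'I_n -> 'I_n -> MB -> R) :=
  forall i j, jet (fun e M => f (rot (skew R i j) e *m M)) f (F1 i j) (F2 i j).

Lemma ljet_expec f F1 F2 : ljet f F1 F2 -> E (fun M => \sum_i \sum_j F2 i j M) = 0.
Proof.
move=> h; rewrite expec_sum //; last first.
  by move=> i; apply: nice_sum => j; case: (h i j).
rewrite big1 // => i _; rewrite expec_sum //; last by move=> j; case: (h i j).
rewrite big1 // => j _; apply: expec_jet2_eq0 (h i j); [exact: skew_trmx|exact: skew3].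
Qed.

Lemma ljet_nice f F1 F2 : ljet f F1 F2 ->
  (forall i j, nice (F1 i j)) /\ (forall i j, nice (F2 i j)).
Proof. by move=> h; split=> i j; case: (h i j). Qed.

(** The Laplacian of [f^2] has mean zero. When [f] is nearly an eigenfunction, this bounds its
    second moment by its mean squared gradient. *)
Lemma ljet_sqr f F1 F2 : ljet f F1 F2 ->
  E (fun M => 2 * f M * (\sum_i \sum_j F2 i j M) + \sum_i \sum_j F1 i j M ^+ 2) = 0.
Proof.
move=> h.
rewrite -[RHS](@ljet_expec _ _ _ (fun i j => jet_mul (h i j) (h i j))).
congr expec; apply/funext => M.
rewrite mulr_sumr -big_split /=; apply: eq_bigr => i _.
by rewrite mulr_sumr -big_split /=; apply: eq_bigr => j _; ring.
Qed.

Lemma ljet_cos f F1 F2 : ljet f F1 F2 ->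
  E (fun M => sin (f M) * (\sum_i \sum_j F2 i j M) +
    2^-1 * (cos (f M) * \sum_i \sum_j F1 i j M ^+ 2)) = 0.
Proof.
move=> h; have := @ljet_expec _ _ _ (fun i j => jet_cos (h i j)).
have [n1 n2] := ljet_nice h.
set F := (X in E X) => E0.
(* The hypothesis tells something about [f] only if there is an index; for [n = 0] the sums are
   empty. *)
have nf : (0 < n)%N -> nice f by move=> n0; case: (h (Ordinal n0) (Ordinal n0)).
have nF : nice F.
  apply: nice_sum => i; apply: nice_sum => j.
  have {}nf := nf (leq_ltn_trans (leq0n _) (ltn_ord i)).
  by nice_tac.
transitivity ((- 1) * E F); last by rewrite E0 mulr0.
rewrite -expecZ //; congr expec; apply/funext => M.
rewrite /F !mulr_sumr -big_split /=; apply: eq_bigr => i _.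
rewrite !mulr_sumr -big_split /=; apply: eq_bigr => j _; ring.
Qed.

Lemma trace_conjO (Q M : 'M[R]_n) : orthogonal M -> \tr (conjO Q M) = \tr Q.
Proof.
by move=> /mulmx1C h; rewrite /conjO mxtrace_mulC mulmxA h mul1mx.
Qed.

Lemma trmx_conjO (Q M : 'M[R]_n) : (conjO Q M)^T = conjO Q^T M.
Proof. by rewrite /conjO !trmx_mul trmxK mulmxA. Qed.

Definition linO (B Q M : 'M[R]_n) : R := \tr (B *m conjO Q M).

Lemma nice_linO B Q : nice (linO B Q).
Proof. by rewrite /linO; nice_tac. Qed.

(** Cyclicity of the trace isolates the generator in the first-order term, so that
    [sum_trace_skew_sq] computes the squared gradient. *)
Lemma ljet_linO B Q : ljet (linO B Q)
  (fun i j M => \tr (skew R i j *m lie (conjO Q M) B))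
  (fun i j M => \tr (B *m lie2 (skew R i j) (conjO Q M))).
Proof.
move=> i j.
apply: (jet_eq (jet_trace (mjet_mul (mjet_cst (mnice_cst B)) (mjet_conjO Q (skew_trmx R i j))))) => M.
- by [].
- rewrite mul0mx addr0 /lie; move: (skew R i j) => X; rewrite !mulmxBr !linearB /=; congr (_ - _).
    by rewrite mulmxA mxtrace_mulC mulmxA mxtrace_mulC !mulmxA.
  by rewrite mulmxA mxtrace_mulC.
- by rewrite !mul0mx !addr0.
Qed.

Lemma sum_lie2_linO B Q M : orthogonal M -> \tr B = 0 ->
  \sum_i \sum_j \tr (B *m lie2 (skew R i j) (conjO Q M)) =
  - (2 * (n%:R - 1)) * linO B Q M - 2 * linO B Q^T M.
Proof.
move=> oM B0.
transitivity (\tr (B *m \sum_i \sum_j lie2 (skew R i j) (conjO Q M))).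
  rewrite mulmx_sumr raddf_sum; apply: eq_bigr => i _.
  by rewrite mulmx_sumr raddf_sum.
rewrite sum_lie2 !mulmxDr !linearD /= mul_mx_scalar mxtraceZ B0 mulr0 addr0.
by rewrite -scalemxAr mxtraceZ mulmxN linearN /= -scalemxAr mxtraceZ trmx_conjO.
Qed.

Lemma nrm_lie_le (Q B : 'M[R]_n) : orthogonal Q -> nrm (lie Q B) <= 4 * nrm B.
Proof.
move=> oQ; apply: (le_trans (nrm_sub _ _)).
by rewrite nrm_mul_orthl // nrm_mul_orthr //; lra.
Qed.

Lemma expec_linO_half B Q : orthogonal Q -> \tr B = 0 ->
  E (fun M => (n%:R - 1) * linO B Q M ^+ 2 + linO B Q M * linO B Q^T M) <= 4 * nrm B.
Proof.
move=> oQ B0.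
have nl := nice_linO B Q; have nl' := nice_linO B Q^T.
have [n1 n2] := ljet_nice (ljet_linO B Q).
have key := ljet_sqr (ljet_linO B Q).
set K := (X in E X = 0) in key.
have nK : nice K by rewrite /K; nice_tac.
(* A function of mean zero may be added freely; [- 4^-1 * K] is the integrand on the left minus a
   quarter of the squared gradient sum, itself at most [16 * nrm B]. *)
have -> : 4 * nrm B = E (fun M => 4 * nrm B + (- 4^-1) * K M).
  by rewrite expecD ?expecZ ?key ?expec_cst ?mulr0 ?addr0 //; nice_tac.
apply: le_expec => //; [by nice_tac|by nice_tac|].
move=> M oM; rewrite /K sum_lie2_linO //.
have := sum_trace_skew_sq_le (lie (conjO Q M) B).
have := nrm_lie_le B (conjO_orthogonal oQ oM).
by set S := \sum_i _; set L := linO B Q M; set L' := linO B Q^T M; set N := nrm (lie _ _); lra.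
Qed.

(** The Laplacian mixes the traces for [Q] and [Q^T]. Adding both inequalities, the cross term is
    absorbed by the square of the sum, which turns [n - 1] into [n - 2]. *)
Lemma expec_linO_le B Q : orthogonal Q -> \tr B = 0 -> (2 <= n)%N ->
  (n%:R - 2) * E (fun M => linO B Q M ^+ 2 + linO B Q^T M ^+ 2) <= 8 * nrm B.
Proof.
move=> oQ B0 n2.
have nl := nice_linO B Q; have nl' := nice_linO B Q^T.
have := expec_linO_half oQ B0.
have := expec_linO_half (orthogonal_trmx oQ) B0; rewrite trmxK => h1 h2.
rewrite -expecZ //; last by nice_tac.
have : E (fun M => (n%:R - 2) * (linO B Q M ^+ 2 + linO B Q^T M ^+ 2)) <=
  E (fun M => ((n%:R - 1) * linO B Q M ^+ 2 + linO B Q M * linO B Q^T M) +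
   ((n%:R - 1) * linO B Q^T M ^+ 2 + linO B Q^T M * linO B Q M)).
  apply: le_expec => //; [by nice_tac|by nice_tac|] => M oM.
  have := sqr_ge0 (linO B Q M + linO B Q^T M); nra.
by rewrite expecD //; [lra|nice_tac|nice_tac].
Qed.

Definition bilO (B Q C Q' M : 'M[R]_n) : R := \tr (B *m conjO Q M *m (C *m conjO Q' M)).

Lemma nice_bilO B Q C Q' : nice (bilO B Q C Q').
Proof. by rewrite /bilO; nice_tac. Qed.

End haar_moments.

(** * Second moments of words with two conjugates *)

Section haar_bilinear.
Variables (R : realType) (n : nat) (mu : probability (mxBorel R n) R).
Hypothesis Hmu : is_Haar_On mu.
Local Notation E := (expec mu).

Lemma ljet_bilO (B Q C Q' : 'M[R]_n) : ljet (bilO B Q C Q')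
  (fun i j M => \tr (skew R i j *m (lie (conjO Q M) (C *m conjO Q' M *m B)
                                 + lie (conjO Q' M) (B *m conjO Q M *m C))))
  (fun i j M => \tr (B *m lie2 (skew R i j) (conjO Q M) *m (C *m conjO Q' M))
     + \tr (B *m lie (skew R i j) (conjO Q M) *m (C *m lie (skew R i j) (conjO Q' M)))
     + \tr (B *m conjO Q M *m (C *m lie2 (skew R i j) (conjO Q' M)))).
Proof.
move=> i j.
have hB := mjet_mul (mjet_cst (mnice_cst B)) (mjet_conjO Q (skew_trmx R i j)).
have hC := mjet_mul (mjet_cst (mnice_cst C)) (mjet_conjO Q' (skew_trmx R i j)).
apply: (jet_eq (jet_trace (mjet_mul hB hC))) => M.
- by [].
- rewrite !mul0mx !addr0; move: (skew R i j) (conjO Q M) (conjO Q' M) => X G G'.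
  rewrite mulmxDr !mxtraceD addrC /lie !(mulmxBr, mulmxBl) !raddfB /= !mulmxA.
  congr (_ - _ + (_ - _)).
  - by do 4 rewrite [LHS]mxtrace_mulC !mulmxA.
  - by do 3 rewrite [LHS]mxtrace_mulC !mulmxA.
  - by do 2 rewrite [LHS]mxtrace_mulC !mulmxA.
  - by rewrite [LHS]mxtrace_mulC !mulmxA.
- by rewrite !mul0mx !addr0 !mxtraceD addrC addrA addrAC.
Qed.

(** Expanding the two commutators leaves words [tr (B' X K X)], summed by [sum_trace_skew2].
    Tracelessness removes two products of traces; the other two are products of [linO] values, whose
    second moments are under control. *)
Lemma sum_cross (B C G G' : 'M[R]_n) : \tr B = 0 -> \tr C = 0 ->
  \sum_i \sum_j \tr (B *m lie (skew R i j) G *m (C *m lie (skew R i j) G')) =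
  2 * \tr (G' *m B *m (G *m C)^T) - 2 * \tr (G' *m B) * \tr (G *m C)
  - 2 * \tr (B *m (G *m C *m G')^T) - 2 * \tr (G' *m B *m G *m C^T)
  + 2 * \tr (B *m G *m (C *m G')^T) - 2 * \tr (B *m G) * \tr (C *m G').
Proof.
move=> B0 C0.
transitivity (\sum_i \sum_j (\tr (G' *m B *m skew R i j *m (G *m C) *m skew R i j)
   - \tr (B *m skew R i j *m (G *m C *m G') *m skew R i j)
   - \tr (G' *m B *m G *m skew R i j *m C *m skew R i j)
   + \tr (B *m G *m skew R i j *m (C *m G') *m skew R i j))).
  apply: eq_bigr => i _; apply: eq_bigr => j _; move: (skew R i j) => X.
  rewrite /lie !(mulmxBr, mulmxBl) !raddfB /= !mulmxA.
  have -> : \tr (G' *m B *m X *m G *m C *m X) = \tr (B *m X *m G *m C *m X *m G').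
    by rewrite [RHS]mxtrace_mulC !mulmxA.
  have -> : \tr (G' *m B *m G *m X *m C *m X) = \tr (B *m G *m X *m C *m X *m G').
    by rewrite [RHS]mxtrace_mulC !mulmxA.
  by ring.
under eq_bigr do rewrite big_split !sumrB /=.
rewrite big_split !sumrB /= !sum_trace_skew2 B0 C0; ring.
Qed.

Lemma bound_trace (B C : 'M[R]_n) (b : R) : nrm B <= b -> nrm C <= b -> `|\tr (B *m C)| <= b.
Proof. by move=> hB hC; have := mxtrace_mul_le B C; lra. Qed.

Lemma bilO_le (B Q C Q' M : 'M[R]_n) (b : R) : orthogonal Q -> orthogonal Q' -> orthogonal M ->
  nrm B <= b -> nrm C <= b -> `|bilO B Q C Q' M| <= b.
Proof.
move=> oQ oQ' oM hB hC; apply: bound_trace; rewrite nrm_mul_orthr //; exact: conjO_orthogonal.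
Qed.

(** The word is nearly an eigenfunction of eigenvalue [- 4 (n - 1)]. In the error, [12] counts six
    words bounded by [b], each with coefficient [2]; [tr Q] and [tr Q'] come from the scalar part of
    [sum_lie2], and the squares from the products of [linO] values. *)
Lemma sum_bilO_le (B Q C Q' M : 'M[R]_n) (b : R) : orthogonal Q -> orthogonal Q' -> orthogonal M ->
  \tr B = 0 -> \tr C = 0 -> nrm B <= b -> nrm C <= b ->
  `| \sum_i \sum_j (\tr (B *m lie2 (skew R i j) (conjO Q M) *m (C *m conjO Q' M))
     + \tr (B *m lie (skew R i j) (conjO Q M) *m (C *m lie (skew R i j) (conjO Q' M)))
     + \tr (B *m conjO Q M *m (C *m lie2 (skew R i j) (conjO Q' M))))
    + 4 * (n%:R - 1) * bilO B Q C Q' M | <=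
  (12 + 2 * `|\tr Q| + 2 * `|\tr Q'|) * b
  + (linO B Q M ^+ 2 + linO B Q' M ^+ 2 + linO C Q M ^+ 2 + linO C Q' M ^+ 2).
Proof.
move=> oQ oQ' oM B0 C0 hB hC.
set G := conjO Q M; set G' := conjO Q' M.
have oG : orthogonal G by exact: conjO_orthogonal.
have oG' : orthogonal G' by exact: conjO_orthogonal.
have tG : \tr G = \tr Q by exact: trace_conjO.
have tG' : \tr G' = \tr Q' by exact: trace_conjO.
under eq_bigr do rewrite !big_split /=; rewrite !big_split /= sum_cross //.
have -> : \sum_i \sum_j \tr (B *m lie2 (skew R i j) G *m (C *m G')) =
   - (2 * (n%:R - 1)) * \tr (B *m G *m (C *m G')) - 2 * \tr (B *m G^T *m (C *m G'))
   + 2 * \tr Q * \tr (B *m (C *m G')).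
  transitivity (\tr (B *m (\sum_i \sum_j lie2 (skew R i j) G) *m (C *m G'))).
    rewrite mulmx_sumr mulmx_suml raddf_sum; apply: eq_bigr => i _.
    by rewrite mulmx_sumr mulmx_suml raddf_sum.
  rewrite sum_lie2 tG mulmxDr mulmxBr mulmxDl mulmxBl mxtraceD raddfB /= -!scalemxAr -!scalemxAl !mxtraceZ.
  by rewrite mul_mx_scalar -scalemxAl mxtraceZ.
have -> : \sum_i \sum_j \tr (B *m G *m (C *m lie2 (skew R i j) G')) =
   - (2 * (n%:R - 1)) * \tr (B *m G *m (C *m G')) - 2 * \tr (B *m G *m (C *m G'^T))
   + 2 * \tr Q' * \tr (B *m G *m C).
  transitivity (\tr (B *m G *m (C *m (\sum_i \sum_j lie2 (skew R i j) G')))).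
    rewrite !mulmx_sumr raddf_sum; apply: eq_bigr => i _.
    by rewrite !mulmx_sumr raddf_sum.
  rewrite sum_lie2 tG' mulmxDr mulmxBr mulmxDr mulmxBr mxtraceD raddfB /= -!scalemxAr !mxtraceZ.
  by rewrite mul_mx_scalar -scalemxAr mxtraceZ.
rewrite /bilO -/G -/G'.
have -> : \tr (G' *m B) = linO B Q' M by rewrite mxtrace_mulC.
have -> : \tr (G *m C) = linO C Q M by rewrite mxtrace_mulC.
rewrite -/(linO B Q M) -/(linO C Q' M); clearbody G G'.
have n1 : `|\tr (B *m G^T *m (C *m G'))| <= b.
  by apply: bound_trace; rewrite nrm_mul_orthr //; exact: orthogonal_trmx.
have n2 : `|\tr (B *m G *m (C *m G'^T))| <= b.
  by apply: bound_trace; rewrite nrm_mul_orthr //; exact: orthogonal_trmx.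
have n3 : `|\tr (B *m (C *m G'))| <= b by apply: bound_trace; rewrite ?nrm_mul_orthr.
have n4 : `|\tr (B *m G *m C)| <= b by apply: bound_trace; rewrite ?nrm_mul_orthr.
have n5 : `|\tr (G' *m B *m (G *m C)^T)| <= b.
  by apply: bound_trace; rewrite ?nrm_trmx ?nrm_mul_orthl.
have n6 : `|\tr (B *m (G *m C *m G')^T)| <= b.
  by apply: bound_trace; rewrite ?nrm_trmx 1?nrm_mul_orthr 1?nrm_mul_orthl.
have n7 : `|\tr (G' *m B *m G *m C^T)| <= b.
  by apply: bound_trace; rewrite ?nrm_trmx 1?nrm_mul_orthr 1?nrm_mul_orthl.
have n8 : `|\tr (B *m G *m (C *m G')^T)| <= b.
  by apply: bound_trace; rewrite ?nrm_trmx ?nrm_mul_orthr.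
have m1 : `|\tr Q * \tr (B *m (C *m G'))| <= `|\tr Q| * b by rewrite normrM ler_wpM2l.
have m2 : `|\tr Q' * \tr (B *m G *m C)| <= `|\tr Q'| * b by rewrite normrM ler_wpM2l.
have am (x y : R) : `|2 * x * y| <= x ^+ 2 + y ^+ 2.
  rewrite ler_norml; apply/andP; split; [have := sqr_ge0 (x + y)|have := sqr_ge0 (x - y)]; nra.
have l1 := am (linO B Q' M) (linO C Q M).
have l2 := am (linO B Q M) (linO C Q' M).
move: n1 n2 n5 n6 n7 n8 m1 m2 l1 l2.
rewrite !ler_norml => /andP[? ?] /andP[? ?] /andP[? ?] /andP[? ?] /andP[? ?] /andP[? ?].
move=> /andP[? ?] /andP[? ?] /andP[? ?] /andP[? ?].
apply/andP; split; lra.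
Qed.

Lemma nrm_bilO_grad_le (B Q C Q' M : 'M[R]_n) (b : R) : orthogonal Q -> orthogonal Q' -> orthogonal M ->
  nrm B <= b -> nrm C <= b ->
  nrm (lie (conjO Q M) (C *m conjO Q' M *m B) + lie (conjO Q' M) (B *m conjO Q M *m C))
    <= 16 * b ^+ 2.
Proof.
move=> oQ oQ' oM hB hC.
have oG := conjO_orthogonal oQ oM; have oG' := conjO_orthogonal oQ' oM.
have b0 : 0 <= b by exact: le_trans (nrm_ge0 B) hB.
have h1 : nrm (C *m conjO Q' M *m B) <= b ^+ 2.
  by rewrite (le_trans (nrm_mul _ _)) // nrm_mul_orthr // expr2 ler_pM ?nrm_ge0.
have h2 : nrm (B *m conjO Q M *m C) <= b ^+ 2.
  by rewrite (le_trans (nrm_mul _ _)) // nrm_mul_orthr // expr2 ler_pM ?nrm_ge0.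
have h3 := nrm_lie_le (C *m conjO Q' M *m B) oG.
have h4 := nrm_lie_le (B *m conjO Q M *m C) oG'.
by apply: (le_trans (nrm_add _ _)); lra.
Qed.

Let bil_arith (T S D N b q u : R) : D <= 4 * (16 * b ^+ 2) ->
  2 * T * (S + 4 * (N - 1) * T) <= 2 * b * ((12 + 2 * q) * b + u) ->
  8 * (N - 1) * T ^+ 2 <= (64 + 2 * (12 + 2 * q)) * b ^+ 2 + 2 * b * u + -1 * (2 * T * S + D).
Proof. lra. Qed.

(** For [b] of order [n], the word has root mean square of order [sqrt n] when the traces are
    bounded, against the pointwise bound [b]. In [2 T] times the Laplacian error, the factor [T] is
    bounded by [b]. *)
Lemma expec_bilO_le (B Q C Q' : 'M[R]_n) (b : R) : orthogonal Q -> orthogonal Q' -> (4 <= n)%N ->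
  \tr B = 0 -> \tr C = 0 -> nrm B <= b -> nrm C <= b ->
  (n%:R - 1) * E (fun M => bilO B Q C Q' M ^+ 2) <=
    (15 + 2^-1 * (`|\tr Q| + `|\tr Q'|)) * b ^+ 2.
Proof.
move=> oQ oQ' n4 B0 C0 hB hC.
have b0 : 0 <= b by exact: le_trans (nrm_ge0 B) hB.
have nb := nice_bilO B Q C Q'.
have l1 := nice_linO B Q; have l2 := nice_linO B Q'.
have l3 := nice_linO C Q; have l4 := nice_linO C Q'.
have ln D S : orthogonal S -> \tr D = 0 -> nrm D <= b -> E (fun M => linO D S M ^+ 2) <= 4 * b.
  move=> oS D0 hD.
  have := expec_linO_le Hmu oS D0 (leq_trans (isT : 2 <= 4)%N n4).
  have : E (fun M => linO D S M ^+ 2) <= E (fun M => linO D S M ^+ 2 + linO D S^T M ^+ 2).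
    have := nice_linO D S; have := nice_linO D S^T => ? ?.
    by apply: le_expec => //; [nice_tac|nice_tac|move=> M _; rewrite lerDl sqr_ge0].
  have n2 : 2 <= n%:R - 2 :> R by rewrite lerBrDr -natrD ler_nat.
  set x := E _; set y := E _ => xy h.
  have := nrm_ge0 D; nra.
have [n1 n2] := ljet_nice (ljet_bilO B Q C Q').
have key := ljet_sqr Hmu (ljet_bilO B Q C Q').
set K := (X in E X = 0) in key.
have nK : nice K by apply: nice_add; [apply: nice_mul; [apply: nice_mul => //; exact: nice_cst|]|];
  (do 2 (apply: nice_sum => ?)); [exact: n2|apply: nice_sqr; exact: n1].
pose U M := linO B Q M ^+ 2 + linO B Q' M ^+ 2 + (linO C Q M ^+ 2 + linO C Q' M ^+ 2).
have nU : nice U by rewrite /U; nice_tac.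
have EU : E U <= 16 * b.
  rewrite /U !expecD //; do ?[by nice_tac].
  by have := ln B Q oQ B0 hB; have := ln B Q' oQ' B0 hB; have := ln C Q oQ C0 hC;
    have := ln C Q' oQ' C0 hC; lra.
set q : R := `|\tr Q| + `|\tr Q'|.
(* The squared gradient gives [64], the words [2 (12 + 2 q)] and the linear traces [2 * 16];
   division by [8] yields [15 + q / 2]. *)
have : E (fun M => 8 * (n%:R - 1) * bilO B Q C Q' M ^+ 2) <=
   E (fun M => (64 + 2 * (12 + 2 * q)) * b ^+ 2 + (2 * b) * U M + (- 1) * K M).
  apply: le_expec => //; [by nice_tac|by nice_tac|] => M oM.
  have h := sum_bilO_le oQ oQ' oM B0 C0 hB hC.
  have g := le_trans (sum_trace_skew_sq_le _) (ler_wpM2l _ (nrm_bilO_grad_le oQ oQ' oM hB hC)).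
  have {}g := g (ler0n R 4).
  have t := bilO_le oQ oQ' oM hB hC.
  move: h g; set S := \sum_i \sum_j (_ + _); set D := \sum_i \sum_j _ ^+ 2.
  set T := bilO _ _ _ _ _ in t *.
  have -> : K M = 2 * T * S + D by [].
  have -> : (12 + 2 * `|\tr Q| + 2 * `|\tr Q'|) * b + (linO B Q M ^+ 2 + linO B Q' M ^+ 2 +
     linO C Q M ^+ 2 + linO C Q' M ^+ 2) = (12 + 2 * q) * b + U M by rewrite /U /q; ring.
  set V := _ + U M => h g.
  have V0 : 0 <= V by exact: le_trans (normr_ge0 _) h.
  have : `|2 * T * (S + 4 * (n%:R - 1) * T)| <= 2 * b * V.
    by rewrite normrM ler_pM // normrM ger0_norm // ler_wpM2l.
  rewrite ler_norml => /andP[_ +]; exact: bil_arith.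
rewrite expecZ //; last by nice_tac.
rewrite !expecD ?expecZ ?key ?expec_cst //; do ?[by nice_tac].
have : 2 * b * E U <= 2 * b * (16 * b) by rewrite ler_wpM2l // mulr_ge0.
set e := E _; set u := E _; lra.
Qed.

End haar_bilinear.

(** * Differentiation by quadratic remainders and the Gaussian differential inequality *)

Section quadratic_remainder.
Variable R : realType.

(** Together with [cos_add_le], this differentiates [E (cos (u X + b))] in [u] from a second moment
    alone, without exchanging a limit and an integral. *)
Lemma is_derive_quadratic (f : R -> R) (x l K : R) :
  (forall h, `|f (x + h) - f x - h * l| <= K * h ^+ 2) -> is_derive x 1 f l.
Proof.
move=> hf.
have K0 : 0 <= K.
  by have := le_trans (normr_ge0 _) (hf 1); rewrite expr1n mulr1.
have cv : (fun h => h^-1 *: (f (h *: 1 + x) - f x)) @ 0^' --> l.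
  apply/cvgrPdist_le => e e0; near=> h.
  have h0 : h != 0 by near: h; exact: nbhs_dnbhs_neq.
  have -> : l - h^-1 *: (f (h *: 1 + x) - f x) = - (h^-1 * (f (x + h) - f x - h * l)).
    by rewrite /GRing.scale /= mulr1 addrC (addrC h); field.
  rewrite normrN normrM normfV ler_pdivrMl ?normr_gt0 // (le_trans (hf h)) //.
  rewrite -real_normK ?num_real // expr2 mulrCA ler_wpM2l //.
  rewrite (@le_trans _ _ ((K + 1) * `|h|)) ?ler_wpM2r ?lerDl //.
  rewrite mulrC -ler_pdivlMr ?ltr_wpDl //.
  near: h; apply: dnbhs0_le; by rewrite divr_gt0 // ltr_wpDl.
apply: DeriveDef; first by apply/cvg_ex; exists l.
exact/cvg_lim.
Unshelve. all: by end_near. Qed.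

Lemma cos_add_le (u h : R) : `|cos (u + h) - cos u + h * sin u| <= 2 * h ^+ 2.
Proof.
rewrite cosD.
have -> : cos u * cos h - sin u * sin h - cos u + h * sin u =
   cos u * (cos h - 1) + (- sin u) * (sin h - h) by ring.
apply: (le_trans (ler_normD _ _)); rewrite mulr_natl mulr2n !normrM normrN.
have hc : `|cos u| <= 1 by rewrite ler_norml cos_geN1 cos_le1.
have hs : `|sin u| <= 1 by rewrite ler_norml sin_geN1 sin_le1.
apply: lerD; rewrite -[X in _ <= X]mul1r ler_pM //; [exact: cos_sub1_le|exact: sin_sub_le2].
Qed.

(* Gronwall for [c' = - s2 t c + O(1 + |t|)] with integrating factor [exp (s2 t^2 / 2)]. *)
Lemma gauss_ode (c dc : R -> R) (s2 D : R) : 0 <= s2 <= 1 -> 0 <= D ->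
  (forall t : R, is_derive t 1 c (dc t)) ->
  (forall t, t != 0 -> `|dc t + s2 * t * c t| <= (1 + `|t|) * D) ->
  forall t, `|c t - expR (- (s2 / 2 * t ^+ 2)) * c 0| <= expR (t ^+ 2) * (1 + `|t|) * `|t| * D.
Proof.
move=> /andP[s0 s1] D0 hc hb t.
pose phi (u : R) := expR (s2 / 2 * u ^+ 2) * c u.
have dphi (u : R) : is_derive u 1 phi (expR (s2 / 2 * u ^+ 2) * (dc u + s2 * u * c u)).
  have d1 : is_derive u 1 (fun v : R => s2 / 2 * v ^+ 2) (s2 * u).
    have -> : (fun v : R => s2 / 2 * v ^+ 2) = (s2 / 2) \*: (id ^+ 2) by [].
    by apply: is_derive_eq; rewrite /GRing.scale /= expr1 mulr1; field.
  have d2 : is_derive u 1 (expR \o (fun v : R => s2 / 2 * v ^+ 2)) (expR (s2 / 2 * u ^+ 2) * (s2 * u)).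
    by apply: is_derive_eq; rewrite /GRing.scale /= mulrC.
  have -> : phi = (expR \o (fun v : R => s2 / 2 * v ^+ 2)) * c by [].
  by apply: is_derive_eq; rewrite /GRing.scale /=; ring.
have := @mvt_bound _ phi _ t (expR (t ^+ 2) * (1 + `|t|) * D) dphi _.
have -> : phi 0 = c 0 by rewrite /phi expr0n /= mulr0 expR0 mul1r.
move=> /(_ _) h.
have {}h : `|phi t - c 0| <= expR (t ^+ 2) * (1 + `|t|) * D * `|t|.
  apply: h => u u0 ut; rewrite normrM ger0_norm ?expR_ge0 // -[leRHS]mulrA.
  have ut2 : u ^+ 2 <= t ^+ 2 by rewrite -(real_normK (num_real u)) -(real_normK (num_real t)) ler_pXn2r ?nnegrE.
  apply: ler_pM => //.
    rewrite ler_expR; have := sqr_ge0 u; nra.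
  by rewrite (le_trans (hb u u0)) // ler_wpM2r // lerD2l.
have e0 : 0 < expR (- (s2 / 2 * t ^+ 2)) by exact: expR_gt0.
have e1 : expR (- (s2 / 2 * t ^+ 2)) <= 1.
  rewrite -[X in _ <= X]expR0 ler_expR oppr_le0 mulr_ge0 ?sqr_ge0 // divr_ge0 //.
have -> : c t - expR (- (s2 / 2 * t ^+ 2)) * c 0 = expR (- (s2 / 2 * t ^+ 2)) * (phi t - c 0).
  by rewrite mulrBr /phi [expR _ * (expR _ * _)]mulrA -expRD addNr expR0 mul1r.
rewrite normrM (gtr0_norm e0) -[X in _ <= X]mul1r ler_pM ?expR_ge0 //.
by rewrite (le_trans h) // mulrAC.
Qed.

End quadratic_remainder.

(** * Normal approximation given the permutation *)

Section haar_stein.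
Variables (R : realType) (n : nat) (mu : probability (mxBorel R n) R).
Hypothesis Hmu : is_Haar_On mu.
Local Notation E := (expec mu).
Variables (B P : 'M[R]_n).
Hypotheses (oP : orthogonal P) (B0 : \tr B = 0).

Lemma ljet_affine f F1 F2 (t b : R) : @ljet R n f F1 F2 ->
  ljet (fun M => t * f M + b) (fun i j M => t * F1 i j M) (fun i j M => t * F2 i j M).
Proof.
move=> h i j.
apply: (jet_eq (jet_add (jet_mul (jet_cst (nice_cst n t)) (h i j)) (jet_cst (nice_cst n b)))) => M //;
  by rewrite /=; ring.
Qed.

(** The fluctuating words of the squared gradient of [W]: [B^T H^T B H], [B H B H] and [B^2 H^2].
    The last is linear in a conjugate because [H^2] is the conjugate of [P^2]. *)
Definition T1 (M : 'M[R]_n) := bilO B^T P^T B P M.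
Definition T2 (M : 'M[R]_n) := bilO B P B P M.
Definition T3 (M : 'M[R]_n) := linO (B *m B) (P *m P) M.

Lemma conjO_sqr (M : 'M[R]_n) : orthogonal M -> conjO P M *m conjO P M = conjO (P *m P) M.
Proof.
move=> /mulmx1C h; rewrite /conjO -!mulmxA; congr (_ *m (_ *m _)).
by rewrite !mulmxA h mul1mx.
Qed.

Lemma sum_grad_sqr M : orthogonal M ->
  \sum_i \sum_j \tr (skew R i j *m lie (conjO P M) B) ^+ 2 =
  2 * (2 * nrm B - 2 * T1 M - 2 * T2 M + 2 * T3 M).
Proof.
move=> oM; rewrite sum_trace_skew_sq.
have oG := conjO_orthogonal oP oM.
rewrite /T3 /linO -conjO_sqr // /T1 /T2 /bilO -trmx_conjO.
move: (conjO P M) oG => G oG.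
have GTG : G^T *m G = 1%:M by exact/mulmx1C.
have -> : \tr (lie G B *m lie G B) = 2 * \tr (B *m G *m (B *m G)) - 2 * \tr (B *m B *m (G *m G)).
  rewrite /lie !(mulmxBl, mulmxBr) !raddfB /= !mulmxA.
  have -> : \tr (G *m B *m G *m B) = \tr (B *m G *m B *m G).
    by rewrite [LHS]mxtrace_mulC !mulmxA.
  have -> : \tr (G *m B *m B *m G) = \tr (B *m B *m G *m G).
    by rewrite [LHS]mxtrace_mulC !mulmxA [LHS]mxtrace_mulC !mulmxA [LHS]mxtrace_mulC !mulmxA.
  have -> : \tr (B *m G *m G *m B) = \tr (B *m B *m G *m G).
    by rewrite [LHS]mxtrace_mulC !mulmxA.
  by ring.
have -> : nrm (lie G B) = 2 * nrm B - 2 * \tr (B^T *m G^T *m (B *m G)).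
  rewrite nrmE /lie [(_ - _)^T]raddfB /= !trmx_mul !(mulmxBl, mulmxBr) !raddfB /=.
  have -> : \tr (B^T *m G^T *m (G *m B)) = nrm B.
    by rewrite nrmE mulmxA -(mulmxA B^T) GTG mulmx1.
  have -> : \tr (G^T *m B^T *m (B *m G)) = nrm B.
    by rewrite -trmx_mul -nrmE nrm_mul_orthr.
  have -> : \tr (G^T *m B^T *m (G *m B)) = \tr (B^T *m G^T *m (B *m G)).
    by rewrite -[LHS]mxtrace_tr !trmx_mul !trmxK !mulmxA.
  by ring.
by ring.
Qed.

Local Notation W := (linO B P).
Local Notation V := (linO B P^T).

(** The vanishing mean of the Laplacian of [cos (t W + b)], divided by [- 2 t]. *)
Lemma stein_identity (t b : R) : t != 0 ->
  E (fun M => sin (t * W M + b) * ((n%:R - 1) * W M + V M)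
    - t * (cos (t * W M + b) * (nrm B - T1 M - T2 M + T3 M))) = 0.
Proof.
move=> t0.
have h := ljet_cos Hmu (ljet_affine t b (ljet_linO B P)).
have nW := nice_linO B P; have nV := nice_linO B P^T.
have nT1 : nice T1 by exact: nice_bilO.
have nT2 : nice T2 by exact: nice_bilO.
have nT3 : nice T3 by exact: nice_linO.
have [n1 n2] := ljet_nice (ljet_affine t b (ljet_linO B P)).
apply: (mulfI (_ : - (2 * t) != 0)); first by rewrite oppr_eq0 mulf_neq0.
rewrite mulr0 -[RHS]h -expecZ //; last by nice_tac.
apply: eq_expec => //.
- by nice_tac.
- by nice_tac.
move=> M oM.
have -> : \sum_i \sum_j t * \tr (B *m lie2 (skew R i j) (conjO P M)) =
   t * (- (2 * (n%:R - 1)) * W M - 2 * V M).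
  rewrite -sum_lie2_linO // mulr_sumr; apply: eq_bigr => i _; by rewrite mulr_sumr.
have -> : \sum_i \sum_j (t * \tr (skew R i j *m lie (conjO P M) B)) ^+ 2 =
   t ^+ 2 * (2 * (2 * nrm B - 2 * T1 M - 2 * T2 M + 2 * T3 M)).
  rewrite -sum_grad_sqr // mulr_sumr; apply: eq_bigr => i _; rewrite mulr_sumr.
  by apply: eq_bigr => j _; rewrite exprMn.
by field.
Qed.

End haar_stein.

Section haar_clt.
Variables (R : realType) (n : nat) (mu : probability (mxBorel R n) R).
Hypothesis Hmu : is_Haar_On mu.
Local Notation E := (expec mu).
Variables (B P : 'M[R]_n) (s2 : R).
Hypotheses (oP : orthogonal P) (B0 : \tr B = 0) (n4 : (4 <= n)%N).
Hypotheses (s01 : 0 <= s2 <= 1) (nB : nrm B = n%:R * s2).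
Local Notation W := (linO B P).
Local Notation V := (linO B P^T).
Let N : R := n%:R.
Let sq : R := Num.sqrt N.

Let N4 : 4 <= N. Proof. by rewrite /N ler_nat. Qed.
Let sq0 : 0 < sq. Proof. by rewrite sqrtr_gt0; have := N4; lra. Qed.
Let sqE : sq ^+ 2 = N. Proof. by rewrite sqr_sqrtr //; have := N4; lra. Qed.
Let sq1 : 1 <= sq. Proof. by have := N4; have := sqE; have := sq0; nra. Qed.
Let nB_le : nrm B <= N. Proof. by case/andP: s01 => _ ?; rewrite nB ler_piMr. Qed.

(** An arithmetic-geometric mean form of Cauchy-Schwarz with a free weight: [l = 1] serves bounded
    second moments, [l = sqrt n] those of order [n]. *)
Lemma expec_norm_le f (l : R) : nice f -> 0 < l ->
  E (fun M => `|f M|) <= 2^-1 * (l + l^-1 * E (fun M => f M ^+ 2)).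
Proof.
move=> nf l0.
have n2 := nice_sqr nf; have na := nice_norm nf.
have -> : 2^-1 * (l + l^-1 * E (fun M => f M ^+ 2)) =
    E (fun M => 2^-1 * l + (2^-1 * l^-1) * f M ^+ 2).
  rewrite expecD ?expecZ ?expec_cst //; do ?[exact: nice_cst|apply: nice_mul|done].
  by rewrite mulrDr mulrA.
apply: le_expec => //.
  by do ?[exact: nice_cst|apply: nice_mul|apply: nice_add|done].
move=> M _; have h : (`|f M| - l) ^+ 2 >= 0 by exact: sqr_ge0.
rewrite -(ler_pM2l l0) -[f M ^+ 2]real_normK ?num_real // mulrDr.
have -> : l * (2^-1 * l^-1 * `|f M| ^+ 2) = 2^-1 * `|f M| ^+ 2 by field; rewrite gt_eqF.
by move: h; rewrite sqrrB; set x := `|f M|; lra.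
Qed.

Lemma expec_W2_le : E (fun M => W M ^+ 2 + V M ^+ 2) <= 16.
Proof.
have := expec_linO_le Hmu oP B0 (leq_trans (isT : 2 <= 4)%N n4).
set e := E _; rewrite -/N => h; have := nB_le; have := N4; nra.
Qed.

Lemma expec_W_le : E (fun M => `|W M|) + E (fun M => `|V M|) <= 9.
Proof.
have nW := nice_linO B P; have nV := nice_linO B P^T.
have h1 := expec_norm_le nW (ltr01 : 0 < 1 :> R).
have h2 := expec_norm_le nV (ltr01 : 0 < 1 :> R).
have := expec_W2_le; rewrite expecD //; [|exact: nice_sqr|exact: nice_sqr].
move: h1 h2; rewrite invr1; lra.
Qed.

(** As [N <= 2 (N - 1)], the second moment is at most [(30 + 2 q) N]; the weight [sqrt N] gives
    [31 / 2 + q], rounded up to [16 + q]. *)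
Lemma expec_bilO_norm_le C D Q Q' : orthogonal Q -> orthogonal Q' ->
  \tr C = 0 -> \tr D = 0 -> nrm C <= N -> nrm D <= N -> \tr Q = \tr P -> \tr Q' = \tr P ->
  E (fun M => `|bilO C Q D Q' M|) <= sq * (16 + `|\tr P|).
Proof.
move=> oQ oQ' C0 D0 hC hD tQ tQ'.
have := expec_bilO_le Hmu oQ oQ' n4 C0 D0 hC hD.
have h := expec_norm_le (nice_bilO C Q D Q') sq0.
move: h; rewrite tQ tQ' -/N; set q : R := `|\tr P|.
set e := E (fun M => bilO _ _ _ _ _ ^+ 2); set a := E _ => h h'.
have q0 : 0 <= q by exact: normr_ge0.
have e1 : e <= (30 + 2 * q) * N.
  have h2 : (N - 1) * e <= (N - 1) * ((30 + 2 * q) * N).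
    apply: (le_trans h').
    have -> : (15 + 2^-1 * (q + q)) * N ^+ 2 = N * (15 + q) * N by field.
    have -> : (N - 1) * ((30 + 2 * q) * N) = (2 * (N - 1)) * (15 + q) * N by ring.
    have := N4 => ?; rewrite !ler_wpM2r //; lra.
  by rewrite -(ler_pM2l (_ : 0 < N - 1)) //; have := N4; lra.
apply: (le_trans h).
have -> : sq * (16 + q) = 2^-1 * (sq + sq^-1 * ((30 + 2 * q) * N) + sq).
  by rewrite -sqE; field; rewrite gt_eqF.
rewrite ler_pM2l ?invr_gt0 // -addrA lerD2l ler_wpDr // ?(ltW sq0) //.
by rewrite ler_wpM2l // invr_ge0 ltW.
Qed.

(** [B^2] is not traceless. Its scalar part contributes a constant at most [|tr (P^2)|]; the centred
    part has second moment at most [64 N], and [(1 + 64) / 2] is rounded up to [33]. *)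
Lemma expec_T3_le : E (fun M => `|T3 B P M|) <= sq * (33 + `|\tr (P *m P)|).
Proof.
pose tau : R := \tr (B *m B).
have htau : `|tau| <= N by apply: bound_trace.
pose B2 : 'M[R]_n := B *m B - (tau / N)%:M.
have N0 : N != 0 by rewrite gt_eqF //; have := N4; lra.
have B20 : \tr B2 = 0.
  by rewrite /B2 raddfB /= mxtrace_scalar -/tau -[X in _ - X]mulr_natr -/N divfK // subrr.
have nB2 : nrm B2 <= 4 * N ^+ 2.
  apply: (le_trans (nrm_sub _ _)).
  have h1 : nrm (B *m B) <= N ^+ 2.
    by rewrite (le_trans (nrm_mul _ _)) // expr2 ler_pM ?nrm_ge0.
  have h2 : nrm ((tau / N)%:M : 'M[R]_n) <= N ^+ 2.
    rewrite nrmE tr_scalar_mx -scalar_mxM mxtrace_scalar -[X in X <= _]mulr_natr -/N.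
    rewrite -expr2 expr_div_n -(real_normK (num_real tau)).
    have -> : `|tau| ^+ 2 / N ^+ 2 * N = `|tau| ^+ 2 / N by field.
    rewrite ler_pdivrMr; last by have := N4; lra.
    have : `|tau| ^+ 2 <= N ^+ 2 by rewrite ler_pXn2r ?nnegrE //; have := N4; lra.
    have := N4; set x := `|tau| ^+ 2; nra.
  lra.
have oPP := orthogonalM oP oP.
have h := expec_linO_le Hmu oPP B20 (leq_trans (isT : 2 <= 4)%N n4).
have nl := nice_linO B2 (P *m P); have nl' := nice_linO B2 (P *m P)^T.
have nl2 := nice_sqr nl; have nl2' := nice_sqr nl'.
have e0 : 0 <= E (fun M => linO B2 (P *m P)^T M ^+ 2).
  rewrite -[X in X <= _](expec_cst mu); apply: le_expec => // [|M _]; last exact: sqr_ge0.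
  exact: nice_cst.
have e1 : E (fun M => linO B2 (P *m P) M ^+ 2) <= 64 * N.
  move: h e0; rewrite expecD // -/N; set x := E _; set y := E _ => h y0.
  have := N4 => ?; have : (N - 2) * x <= (N - 2) * (64 * N) by nra.
  by rewrite ler_pM2l //; lra.
have e2 : E (fun M => `|linO B2 (P *m P) M|) <= sq * 33.
  apply: (le_trans (expec_norm_le nl sq0)).
  have -> : sq * 33 = 2^-1 * (sq + sq^-1 * (64 * N) + sq).
    by rewrite -sqE; field; rewrite gt_eqF.
  rewrite ler_pM2l ?invr_gt0 // -addrA lerD2l ler_wpDr // ?(ltW sq0) //.
  by rewrite ler_wpM2l // invr_ge0 ltW.
have nT3 : nice (T3 B P) by exact: nice_linO.
have : E (fun M => `|T3 B P M|) <= E (fun M => `|\tr (P *m P)| + `|linO B2 (P *m P) M|).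
  apply: le_expec => //; [exact: nice_norm|apply: nice_add; [exact: nice_cst|exact: nice_norm]|].
  move=> M oM.
  have -> : T3 B P M = tau / N * \tr (P *m P) + linO B2 (P *m P) M.
    rewrite /T3 /linO /B2 mulmxBl raddfB /= mul_scalar_mx mxtraceZ trace_conjO //.
    by rewrite addrC subrK.
  apply: (le_trans (ler_normD _ _)); rewrite lerD2r normrM ler_piMl //.
  rewrite normrM normfV (ger0_norm (_ : 0 <= N)); last by have := N4; lra.
  by rewrite ler_pdivrMr ?mul1r //; have := N4; lra.
rewrite expecD ?expec_cst //; [|exact: nice_cst|exact: nice_norm].
have := sq1; have := normr_ge0 (\tr (P *m P)); set q := `|_|; set x := E _; set y := E _ in e2 *.
nra.
Qed.

(** [65 = 16 + 16 + 33] adds the bounds for [T1], [T2] and [T3]; it also covers the [9] coming from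
    [|W| + |V|]. *)
Let D : R := (65 + 2 * `|\tr P| + `|\tr (P *m P)|) / sq.

Lemma haar_stein_bound (t b : R) : t != 0 ->
  `|E (fun M => W M * sin (t * W M + b)) - s2 * t * E (fun M => cos (t * W M + b))|
   <= (1 + `|t|) * D.
Proof.
move=> t0.
have nW := nice_linO B P; have nV := nice_linO B P^T.
have nT1 : nice (T1 B P) by exact: nice_bilO.
have nT2 : nice (T2 B P) by exact: nice_bilO.
have nT3 : nice (T3 B P) by exact: nice_linO.
have nf : nice (fun M => t * W M + b).
  by apply: nice_add; [apply: nice_mul => //; exact: nice_cst|exact: nice_cst].
have ns := nice_sin nf; have nc := nice_cos nf.
have key := stein_identity Hmu oP B0 b t0.
(* This is [N (W sin - s2 t cos)] minus the function [A] below, whose mean vanishes by [key];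
   [W - V] compensates [(N - 1) W + V]. *)
pose F M := sin (t * W M + b) * (W M + (- 1) * V M) +
   t * (cos (t * W M + b) * (((- 1) * T1 B P M + (- 1) * T2 B P M) + T3 B P M)).
have nF : nice F.
  by rewrite /F; do ?[exact: nice_cst|done|apply: nice_mul|apply: nice_add].
pose A M := sin (t * W M + b) * ((N - 1) * W M + V M)
    - t * (cos (t * W M + b) * (nrm B - T1 B P M - T2 B P M + T3 B P M)).
have nA : nice A.
  rewrite /A; apply: nice_add; first by do ?[exact: nice_cst|done|apply: nice_mul|apply: nice_add].
  apply: nice_opp; apply: nice_mul; first exact: nice_cst.
  apply: nice_mul => //.
  by do ?[exact: nice_cst|done|apply: nice_opp|apply: nice_mul|apply: nice_add].
have e : E (fun M => W M * sin (t * W M + b)) - s2 * t * E (fun M => cos (t * W M + b)) = N^-1 * E F.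
  have N0 : N != 0 by rewrite gt_eqF //; have := N4; lra.
  have nWs : nice (fun M => W M * sin (t * W M + b)) by exact: nice_mul.
  have h : E F + E A = E (fun M => N * (W M * sin (t * W M + b)) + (- (N * s2 * t)) * cos (t * W M + b)).
    rewrite -expecD //; congr expec; apply/funext => M; rewrite /F /A nB -/N; ring.
  apply: (mulfI N0); rewrite mulrA divff // mul1r -[RHS]addr0 -[X in _ = _ + X]key h.
  rewrite expecD //; [|by apply: nice_mul => //; exact: nice_cst|by apply: nice_mul => //; exact: nice_cst].
  rewrite !expecZ //; ring.
have cb x : `|cos x| <= 1 :> R by rewrite ler_norml cos_geN1 cos_le1.
have sb x : `|sin x| <= 1 :> R by rewrite ler_norml sin_geN1 sin_le1.
have a1 := nice_norm nW; have a2 := nice_norm nV; have a3 := nice_norm nT1.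
have a4 := nice_norm nT2; have a5 := nice_norm nT3.
have bF : E (fun M => `|F M|) <= E (fun M => `|W M| + `|V M|) +
   `|t| * E (fun M => (`|T1 B P M| + `|T2 B P M|) + `|T3 B P M|).
  have m1 : nice (fun M => `|W M| + `|V M|) by exact: nice_add.
  have m2 : nice (fun M => (`|T1 B P M| + `|T2 B P M|) + `|T3 B P M|) by do 2 apply: nice_add => //.
  rewrite -expecZ // -expecD //; last by apply: nice_mul => //; exact: nice_cst.
  apply: le_expec => //; [exact: nice_norm| |].
    by apply: nice_add => //; apply: nice_mul => //; exact: nice_cst.
  move=> M _; apply: (le_trans (ler_normD _ _)); apply: lerD.
    rewrite normrM -[X in _ <= X]mul1r ler_pM // mulN1r; exact: ler_normB.
  rewrite normrM ler_wpM2l // normrM -[X in _ <= X]mul1r ler_pM // !mulN1r.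
  apply: (le_trans (ler_normD _ _)); rewrite lerD2r.
  by apply: (le_trans (ler_normD _ _)); rewrite !normrN.
have tP : \tr P^T = \tr P by exact: mxtrace_tr.
have oPT := orthogonal_trmx oP.
have BT0 : \tr B^T = 0 by rewrite mxtrace_tr.
have nBT : nrm B^T <= N by rewrite nrm_trmx.
have hT1 := expec_bilO_norm_le oPT oP BT0 B0 nBT nB_le tP (erefl _).
have hT2 := expec_bilO_norm_le oP oP B0 B0 nB_le nB_le (erefl _) (erefl _).
have hT3 := expec_T3_le; have hW := expec_W_le.
rewrite e normrM normfV (ger0_norm (_ : 0 <= N)); last by have := N4; lra.
rewrite ler_pdivrMl; last by have := N4; lra.
apply: (le_trans (ler_norm_expec Hmu nF)); apply: (le_trans bF).
move: hT1 hT2 hT3 hW; rewrite -/(T1 B P) -/(T2 B P).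
rewrite !expecD //; [|exact: nice_add].
set q := `|\tr P|; set q2 := `|\tr (P *m P)|.
set x1 := E _; set x2 := E _; set x3 := E _ => hT1 hT2 hT3 hW.
have -> : N * ((1 + `|t|) * D) = sq * (65 + 2 * q + q2) + `|t| * (sq * (65 + 2 * q + q2)).
  by rewrite /D -/q -/q2 -sqE; field; rewrite gt_eqF.
have q0 : 0 <= q by exact: normr_ge0.
have q20 : 0 <= q2 by exact: normr_ge0.
apply: lerD.
  apply: (le_trans hW); have := sq1; nra.
rewrite ler_wpM2l //; move: hT1 hT2 hT3; rewrite /T1 /T2; lra.
Qed.

Lemma haar_clt_bound (t b : R) :
  `|E (fun M => cos (t * W M + b)) - expR (- (s2 / 2 * t ^+ 2)) * cos b|
    <= expR (t ^+ 2) * (1 + `|t|) * `|t| * D.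
Proof.
have nW := nice_linO B P.
have nf u : nice (fun M => u * W M + b).
  by apply: nice_add; [apply: nice_mul => //; exact: nice_cst|exact: nice_cst].
have D0 : 0 <= D.
  by rewrite /D divr_ge0 ?(ltW sq0) // !addr_ge0 // mulr_ge0.
pose c (u : R) := E (fun M => cos (u * W M + b)).
pose dc (u : R) := (- 1) * E (fun M => W M * sin (u * W M + b)).
have c0 : c 0 = cos b.
  by rewrite /c; under eq_fun do rewrite mul0r add0r; exact: expec_cst.
have dcP (u : R) : is_derive u 1 c (dc u).
  apply: (@is_derive_quadratic _ _ _ _ (2 * E (fun M => W M ^+ 2))) => h.
  have ns := nice_sin (nf u); have nc := nice_cos (nf u); have nc' := nice_cos (nf (u + h)).
  have nWs := nice_mul nW ns.
  have -> : c (u + h) - c u - h * dc u = E (fun M => (cos ((u + h) * W M + b) +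
     (- 1) * cos (u * W M + b)) + h * (W M * sin (u * W M + b))).
    rewrite !expecD ?expecZ /c /dc //; do ?[exact: nice_cst|done|apply: nice_mul|apply: nice_add].
    by ring.
  have nn : nice (fun M => (cos ((u + h) * W M + b) +
     (- 1) * cos (u * W M + b)) + h * (W M * sin (u * W M + b))).
    by do ?[exact: nice_cst|done|apply: nice_mul|apply: nice_add].
  apply: (le_trans (ler_norm_expec Hmu nn)).
  rewrite mulrAC -expecZ //; last exact: nice_sqr.
  apply: le_expec => //; first exact: nice_norm.
    by apply: nice_mul; [exact: nice_cst|exact: nice_sqr].
  move=> M _; have := cos_add_le (u * W M + b) (h * W M).
  have -> : u * W M + b + h * W M = (u + h) * W M + b by ring.
  by rewrite mulN1r exprMn !mulrA.
have := @gauss_ode R c dc s2 D s01 D0 dcP _ t; rewrite c0; apply => u u0.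
rewrite /dc mulN1r addrC -normrN opprB; exact: haar_stein_bound.
Qed.

End haar_clt.

(** * Fixed points of random permutations *)

Section fixed_points.
Variable R : realType.

Definition fixp n (s : 'S_n) : nat := \sum_i (s i == i).

Definition pavg n (h : 'S_n -> R) : R := (n`!%:R)^-1 * \sum_(s : 'S_n) h s.

Lemma fact_neq0 n : (n`!%:R : R) != 0.
Proof. by rewrite pnatr_eq0 -lt0n fact_gt0. Qed.

Lemma pavg_cst n (c : R) : pavg (fun _ : 'S_n => c) = c.
Proof.
by rewrite /pavg sumr_const card_Sn -[c *+ _]mulr_natl mulrA mulVf ?mul1r // fact_neq0.
Qed.

Lemma pavgD n (g h : 'S_n -> R) : pavg (fun s => g s + h s) = pavg g + pavg h.
Proof. by rewrite /pavg big_split mulrDr. Qed.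

Lemma pavgZ n c (h : 'S_n -> R) : pavg (fun s => c * h s) = c * pavg h.
Proof. by rewrite /pavg -mulr_sumr mulrCA. Qed.

Lemma pavg_sum n (I : Type) (r : seq I) (Q : pred I) (h : I -> 'S_n -> R) :
  pavg (fun s => \sum_(k <- r | Q k) h k s) = \sum_(k <- r | Q k) pavg (h k).
Proof. by rewrite /pavg exchange_big /= mulr_sumr. Qed.

Lemma le_pavg n (g h : 'S_n -> R) : (forall s, g s <= h s) -> pavg g <= pavg h.
Proof. by move=> gh; rewrite /pavg ler_wpM2l ?invr_ge0 // ler_sum. Qed.

Lemma ler_norm_pavg n (h : 'S_n -> R) : `|pavg h| <= pavg (fun s => `|h s|).
Proof.
by rewrite /pavg normrM ger0_norm ?invr_ge0 // ler_wpM2l ?invr_ge0 // ler_norm_sum.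
Qed.

Lemma mxtrace_perm n (s : 'S_n) : \tr (perm_mx s : 'M[R]_n) = (fixp s)%:R.
Proof. by rewrite /fixp natr_sum; apply: eq_bigr => i _; rewrite !mxE. Qed.

Lemma fixp_le n (s : 'S_n) : (fixp s <= n)%N.
Proof.
rewrite -[X in (_ <= X)%N]card_ord -sum1_card /fixp; apply: leq_sum => i _.
by case: eqP.
Qed.

Lemma fixp_lift n i (s : 'S_n) : fixp (lift_perm i i s) = (fixp s).+1.
Proof.
rewrite /fixp (bigD1_ord i) //= lift_perm_id eqxx add1n; congr _.+1.
by apply: eq_bigr => j _; rewrite lift_perm_lift (inj_eq lift_inj).
Qed.

Lemma lift_perm_inj n (i : 'I_n.+1) : injective (@lift_perm n i i).
Proof.
move=> s t st; apply/permP => k; apply: (@lift_inj _ i).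
by rewrite -(lift_perm_lift i) -(lift_perm_lift i i t) st.
Qed.

Lemma lift_perm_surj n (i : 'I_n.+1) (s : 'S_n.+1) : s i = i ->
  exists t, lift_perm i i t = s.
Proof.
move=> si.
have h k : {k' | s (lift i k) = lift i k'}.
  case: (unliftP i (s (lift i k))) => [k' e|e]; first by exists k'.
  by exfalso; move: (neq_lift i k) => /eqP; apply; rewrite (perm_inj (etrans e (esym si))).
pose f k := sval (h k).
have fi : injective f.
  move=> k l e; apply: (@lift_inj _ i); apply: (@perm_inj _ s).
  by rewrite (svalP (h k)) (svalP (h l)) -/(f k) -/(f l) e.
exists (perm fi); apply/permP => k; case: (unliftP i k) => [k' ->|->].
  by rewrite lift_perm_lift permE; exact: esym (svalP (h k')).
by rewrite lift_perm_id.
Qed.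

Lemma sum_fixed n (i : 'I_n.+1) (F : 'S_n.+1 -> R) :
  \sum_(s : 'S_n.+1 | s i == i) F s = \sum_(t : 'S_n) F (lift_perm i i t).
Proof.
rewrite (reindex (@lift_perm n i i)) /=; last first.
  (* The inverse is found by search; the default is reached only for permutations that move [i]. *)
  exists (fun s => odflt 1%g [pick t | lift_perm i i t == s]) => s.
    by move=> _; case: pickP => [t /eqP/lift_perm_inj //|/(_ s)]; rewrite eqxx.
  rewrite inE => /eqP si; case: pickP => [t /eqP //|].
  by have [t <-] := lift_perm_surj si => /(_ t); rewrite eqxx.
by apply: eq_bigl => t; rewrite lift_perm_id eqxx.
Qed.

(** Counting pairs of a permutation and one of its fixed points: deleting the point leaves an
    arbitrary permutation of [n] points with one fixed point fewer, and the [n + 1] choices turn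
    [(n + 1)!] into [n!]. *)
Lemma pavg_fixp_rec n (h : nat -> R) :
  pavg (fun s : 'S_n.+1 => (fixp s)%:R * h (fixp s)) = pavg (fun t : 'S_n => h (fixp t).+1).
Proof.
rewrite /pavg.
have -> : \sum_(s : 'S_n.+1) (fixp s)%:R * h (fixp s) =
    n.+1%:R * \sum_(t : 'S_n) h (fixp t).+1.
  transitivity (\sum_(s : 'S_n.+1) \sum_i ((s i == i)%:R * h (fixp s))).
    by apply: eq_bigr => s _; rewrite -mulr_suml {1}/fixp natr_sum.
  rewrite exchange_big /=.
  transitivity (\sum_(i < n.+1) \sum_(t : 'S_n) h (fixp t).+1).
    apply: eq_bigr => i _.
    transitivity (\sum_(s : 'S_n.+1 | s i == i) h (fixp s)).
      by rewrite [RHS]big_mkcond; apply: eq_bigr => s _; case: eqP; rewrite ?mul1r ?mul0r.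
    by rewrite sum_fixed; apply: eq_bigr => t _; rewrite fixp_lift.
  by rewrite sumr_const card_ord mulr_natl.
have m0 : (n.+1%:R : R) != 0 by rewrite pnatr_eq0.
by rewrite mulrA factS natrM invfM; congr (_ * _); rewrite mulrAC mulVf // mul1r.
Qed.

Lemma pavg_fixp n : pavg (fun s : 'S_n.+1 => (fixp s)%:R) = 1.
Proof.
rewrite -[RHS](pavg_cst n) -[RHS](pavg_fixp_rec n (fun=> 1)).
by congr pavg; apply/funext => s; rewrite mulr1.
Qed.

Lemma pavg_bin n j : (j <= n)%N -> pavg (fun s : 'S_n => 'C(fixp s, j)%:R) = (j`!%:R)^-1.
Proof.
elim: j n => [|j ih] n jn; first by under eq_fun do rewrite bin0; rewrite pavg_cst fact0 invr1.
case: n jn => // n jn.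
have := pavg_fixp_rec n (fun k => 'C(k.-1, j)%:R); rewrite /= ih // => h.
have j0 : (j.+1%:R : R) != 0 by rewrite pnatr_eq0.
rewrite factS natrM invfM -h -pavgZ; congr pavg; apply/funext => s.
by rewrite -natrM mul_bin_diag natrM mulrA mulVf // mul1r.
Qed.

(** Inclusion-exclusion for having no fixed point. Summing up to [n] instead of [m] gives a range
    independent of the permutation; the extra binomials vanish. *)
Lemma alt_sum_bin (m n : nat) : (m <= n)%N ->
  \sum_(j < n.+1) (-1) ^+ j * 'C(m, j)%:R = (m == 0%N)%:R :> R.
Proof.
move=> mn; have := @exprBn R 1 1 m; rewrite subrr expr0n => ->.
rewrite (big_ord_widen n.+1 (fun i => (-1) ^+ i * 1 ^+ (m - i) * 1 ^+ i *+ 'C(m, i))) //.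
rewrite [RHS]big_mkcond; apply: eq_bigr => i _; rewrite !expr1n !mulr1 mulr_natr.
by case: ltnP => // h; rewrite bin_small.
Qed.

Definition fixprob n k := pavg (fun s : 'S_n => (fixp s == k)%:R).

(** The proportion of derangements: each factorial moment up to order [n] is exactly that of the
    Poisson law, which leaves a partial sum of [exp (- 1)]. *)
Lemma fixprob0 n : fixprob n 0 = series (exp_coeff (-1)) n.+1.
Proof.
rewrite /fixprob; under eq_fun do rewrite -(alt_sum_bin (fixp_le _)).
rewrite pavg_sum /series /= big_mkord; apply: eq_bigr => j _.
by rewrite pavgZ pavg_bin // -ltnS.
Qed.

Lemma fixprobS n k : fixprob n.+1 k.+1 = (k.+1%:R)^-1 * fixprob n k.
Proof.
have := pavg_fixp_rec n (fun j => (j == k.+1)%:R); rewrite /= => h.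
have k0 : (k.+1%:R : R) != 0 by rewrite pnatr_eq0.
apply: (mulfI k0); rewrite [RHS]mulrA divff // mul1r /fixprob.
transitivity (pavg (fun s : 'S_n.+1 => (fixp s)%:R * (fixp s == k.+1)%:R)).
  by rewrite -pavgZ; congr pavg; apply/funext => s; case: eqP => [->//|]; rewrite !mulr0.
by rewrite h; congr pavg; apply/funext => s; rewrite eqSS.
Qed.

Lemma cvg_fixprob k : fixprob n k @[n --> \oo] --> poisson_pmf 1 k.
Proof.
rewrite /poisson_pmf ltr01 expr1n mul1r; elim: k => [|k ih].
  rewrite fact0 invr1 mul1r.
  have -> : (fun n => fixprob n 0) = (fun n => series (exp_coeff (-1)) n.+1).
    by apply/funext => n; exact: fixprob0.
  rewrite (cvg_shiftS (series (exp_coeff (-1)))).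
  exact: is_cvg_series_exp_coeff.
rewrite -(cvg_shiftS (fun n => fixprob n k.+1)) /=.
have -> : (fun n => fixprob n.+1 k.+1) = (fun n => (k.+1%:R)^-1 * fixprob n k).
  by apply/funext => n; exact: fixprobS.
by rewrite factS natrM invfM -mulrA; exact: cvgMl_tmp.
Qed.

(** A limit of sums of probabilities of disjoint events. *)
Lemma sum_poisson_le1 m : \sum_(k < m) poisson_pmf (1 : R) k <= 1.
Proof.
have h n : \sum_(k < m) fixprob n k <= 1.
  rewrite -pavg_sum -[X in _ <= X](@pavg_cst n); apply: le_pavg => s.
  have [fm|fm] := ltnP (fixp s) m.
    rewrite (bigD1 (Ordinal fm)) //= eqxx big1 ?addr0 // => i; rewrite -val_eqE /= eq_sym.
    by move=> /negbTE ->.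
  rewrite big1 // => i _; case: eqP => // e; by have := ltn_ord i; rewrite -e ltnNge fm.
have c : \sum_(k < m) fixprob n k @[n --> \oo] --> \sum_(k < m) poisson_pmf (1 : R) k.
  by apply: cvg_big => [|k _]; [exact: add_continuous|exact: cvg_fixprob].
by rewrite -(cvg_lim _ c) //; apply: limr_le; [apply/cvg_ex; eexists; exact: c|near=> n; exact: h].
Unshelve. all: by end_near. Qed.

End fixed_points.

Section fixed_points_limit.
Variable R : realType.

Lemma is_cvg_poisson_series (h : nat -> R) (C : R) : (forall k, `|h k| <= C) ->
  cvgn (series (fun k => poisson_pmf 1 k * h k)).
Proof.
move=> hC; have C0 : 0 <= C := le_trans (normr_ge0 _) (hC 0%N).
apply: normed_cvg; apply: nondecreasing_is_cvgn.
  by apply: nondecreasing_series => k _ _; exact: normr_ge0.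
exists C => _ [m _ <-].
have -> : [normed series (fun k : nat => poisson_pmf 1 k * h k)] m = \sum_(k < m) `|poisson_pmf 1 k * h k|.
  by rewrite -(big_mkord xpredT (fun k => `|poisson_pmf 1 k * h k|)).
apply: (@le_trans _ _ (\sum_(k < m) poisson_pmf 1 k * C)).
  apply: ler_sum => k _; rewrite normrM ger0_norm ?poisson_pmf_ge0 //.
  by rewrite ler_wpM2l ?poisson_pmf_ge0.
by rewrite -mulr_suml ler_piMl // sum_poisson_le1.
Qed.

(** Markov's inequality with mean one, hence uniform in [n]. *)
Lemma pavg_fixp_trunc n (h : nat -> R) (C : R) K : (forall k, `|h k| <= C) ->
  (0 < n)%N -> (0 < K)%N ->
  `|pavg (fun s : 'S_n => h (fixp s)) - \sum_(k < K) fixprob R n k * h k| <= C / K%:R.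
Proof.
case: n => // n hC _ K0; have C0 : 0 <= C := le_trans (normr_ge0 _) (hC 0%N).
have -> : \sum_(k < K) fixprob R n.+1 k * h k =
   pavg (fun s : 'S_n.+1 => \sum_(k < K) h k * (fixp s == k)%:R).
  by rewrite pavg_sum; apply: eq_bigr => k _; rewrite pavgZ mulrC.
rewrite -[X in _ - X]mul1r -mulNr -pavgZ -pavgD.
apply: (le_trans (ler_norm_pavg _)).
have -> : C / K%:R = pavg (fun s : 'S_n.+1 => C / K%:R * (fixp s)%:R).
  by rewrite pavgZ pavg_fixp mulr1.
apply: le_pavg => s.
have KR : 0 < K%:R :> R by rewrite ltr0n.
have [fm|fm] := ltnP (fixp s) K.
  rewrite (bigD1 (Ordinal fm)) //= eqxx big1 ?addr0 => [|i]; last first.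
    by rewrite -val_eqE /= eq_sym => /negbTE ->; rewrite mulr0.
  by rewrite mulr1 mulN1r subrr normr0 mulr_ge0 // divr_ge0.
rewrite big1 ?mulr0 ?addr0; last first.
  move=> i _; case: eqP => [e|]; last by rewrite mulr0.
  by have := ltn_ord i; rewrite -e ltnNge fm.
rewrite (le_trans (hC _)) // -mulrA ler_peMr // mulrC ler_pdivlMr // mul1r ler_nat //.
Qed.

Lemma cvg_pavg_poisson (h : nat -> R) (C : R) : (forall k, `|h k| <= C) ->
  pavg (fun s : 'S_n => h (fixp s)) @[n --> \oo] -->
  \big[+%R/0%R]_(0 <= k <oo) (poisson_pmf 1 k * h k).
Proof.
move=> hC; have C0 : 0 <= C := le_trans (normr_ge0 _) (hC 0%N).
have /cvgrPdist_le cS := is_cvg_poisson_series hC.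
set S := lim _ in cS.
apply/cvgrPdist_le => e e0; rewrite -/S.
have e3 : 0 < e / 3 by rewrite divr_gt0.
have [K [K0 K1 K2]] : exists K, [/\ (0 < K)%N, C / K%:R <= e / 3 &
   `|S - \sum_(k < K) poisson_pmf 1 k * h k| <= e / 3].
  near \oo => K; exists K.
  have K0 : (0 < K)%N by near: K; exact: nbhs_infty_gt.
  split => //.
    rewrite ler_pdivrMr ?ltr0n // mulrC -ler_pdivrMr //; near: K; exact: nbhs_infty_ger.
  have : `|S - series (fun k => poisson_pmf 1 k * h k) K| <= e / 3.
    by near: K; exact: cS.
  by rewrite /series /= big_mkord.
have c : \sum_(k < K) fixprob R n k * h k @[n --> \oo] --> \sum_(k < K) poisson_pmf 1 k * h k.
  apply: cvg_big => [|k _]; first exact: add_continuous.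
  by apply: cvgMr_tmp; exact: cvg_fixprob.
move/cvgrPdist_le: c => /(_ _ e3) c.
near=> n.
have n0 : (0 < n)%N by near: n; exact: nbhs_infty_gt.
have h1 : `|\sum_(k < K) poisson_pmf 1 k * h k - \sum_(k < K) fixprob R n k * h k| <= e / 3.
  by near: n.
have h2 : `|pavg (fun s : 'S_n => h (fixp s)) - \sum_(k < K) fixprob R n k * h k| <= e / 3.
  by apply: le_trans K1; exact: pavg_fixp_trunc.
move: K2 h1 h2; set a := \sum_(k < K) poisson_pmf _ _ * _; set b := \sum_(k < K) _; set p := pavg _.
rewrite !ler_norml => /andP[? ?] /andP[? ?] /andP[? ?]; apply/andP; split; lra.
Unshelve. all: by end_near. Qed.

(** The square fixes the fixed points and the points lying in 2-cycles. A given point is in a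
    2-cycle with probability at most [1 / (n - 2)]. *)
Lemma pavg_fixp_sqr n : (3 <= n)%N ->
  pavg (fun s : 'S_n => (fixp (s * s)%g)%:R) <= 1 + n%:R / (n%:R - 2) :> R.
Proof.
move=> n3.
have n2 : 0 < n%:R - 2 :> R by rewrite subr_gt0 ltr_nat.
pose a i (s : 'S_n) : R := ((s (s i) == i) && (s i != i))%:R.
have spl (s : 'S_n) : (fixp (s * s)%g)%:R <= (fixp s)%:R + \sum_i a i s :> R.
  rewrite /fixp !natr_sum -big_split /=; apply: ler_sum => i _; rewrite /a permM -natrD ler_nat.
  by case: (eqVneq (s i) i) => [->|_]; rewrite ?eqxx ?andbT //; case: eqP.
have ai i : pavg (a i) <= (n%:R - 2)^-1.
  rewrite -[X in _ <= X]mul1r ler_pdivlMr // mulrC.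
  (* When [i] and [s i] form a 2-cycle, exactly [n - 2] values [k] differ from both. *)
  have -> : (n%:R - 2) * pavg (a i) =
     \sum_(k | k != i) pavg (fun s => ((s (s i) == i) && (s i != i) && (s i != k))%:R : R).
    rewrite -pavg_sum -pavgZ; congr pavg; apply/funext => s; rewrite /a.
    case: (boolP ((s (s i) == i) && (s i != i))) => [/andP[h1 h2]|_]; last by rewrite big1 ?mulr0.
    rewrite mulr1 -natr_sum (bigD1 (s i)) //= eqxx add0n.
    have -> : (\sum_(k | (k != i) && (k != s i)) (s i != k) = n - 2)%N.
      transitivity (\sum_(k | (k != i) && (k != s i)) 1)%N.
        by apply: eq_bigr => k /andP[_]; rewrite eq_sym => ->.
      rewrite sum1_card.
      have e := cardC (pred2 i (s i)); rewrite card_ord card2 eq_sym h2 /= in e.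
      rewrite -[X in _ = (X - _)%N]e addKn; apply: eq_card => k; rewrite !inE negb_or //.
    by rewrite natrB // (leq_trans _ n3).
  have e1 : (1 : R) = \sum_k pavg (fun s : 'S_n => (s (s i) == k)%:R).
    rewrite -pavg_sum -[LHS](pavg_cst n); congr pavg; apply/funext => s.
    rewrite (bigD1 (s (s i))) //= eqxx big1 ?addr0 // => k; rewrite eq_sym => /negbTE -> //.
  rewrite [X in _ <= X]e1 [X in _ <= X](bigD1 i) //= ler_wpDl //.
    by rewrite /pavg mulr_ge0 ?invr_ge0 // sumr_ge0.
  apply: ler_sum => k ki; rewrite /pavg ler_wpM2l ?invr_ge0 //.
  (* Following [s] by the transposition of [i] and [k] sends such a permutation to one whose square
     maps [i] to [k]; these events are disjoint over [k]. *)
  rewrite [X in _ <= X](reindex_inj (mulIg (tperm i k))) /=; apply: ler_sum => s _.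
  rewrite ler_nat; case: (boolP (_ && _)) => // /andP[/andP[/eqP h1 h2] h3].
  have e : tperm i k (s i) = s i by rewrite tpermD // eq_sym.
  by rewrite !permM e h1 tpermL eqxx.
apply: (@le_trans _ _ (pavg (fun s : 'S_n => (fixp s)%:R + \sum_i a i s))).
  exact: le_pavg.
rewrite pavgD pavg_sum; apply: lerD.
  by case: n n3 {n2 a spl ai} => // n _; rewrite pavg_fixp.
apply: (@le_trans _ _ (\sum_(i < n) (n%:R - 2)^-1)); first by apply: ler_sum => i _; exact: ai.
by rewrite sumr_const card_ord -[X in X <= _]mulr_natl.
Qed.

End fixed_points_limit.

(** * The Gaussian characteristic function *)

Section gauss.
Variable R : realType.
Local Notation mu := (@lebesgue_measure R).
Local Notation pdf := (@normal_pdf R 0 1).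

Definition gexp (f : R -> R) : R := Rintegral mu setT (fun x => f x * pdf x).
(** Quadratic growth accommodates the second moment needed for differentiating in the frequency. *)
Definition gint (f : R -> R) : Prop := measurable_fun [set: R] f /\
  exists C : R, forall x, `|f x| <= C * (1 + x ^+ 2).

Lemma pdf_ge0 x : 0 <= pdf x. Proof. exact: normal_pdf_ge0. Qed.

Lemma pdfE x : pdf x = normal_peak 1 * expR (- (x ^+ 2 / 2)).
Proof.
rewrite normal_pdfE ?oner_neq0 // /normal_fun subr0 expr1n; congr (_ * expR _).
by rewrite mulNr.
Qed.

(** Domination by the density of standard deviation [2], from [1 + x^2 <= 3 (1 + 3 x^2 / 8) <= 3 exp
    (3 x^2 / 8)]. *)
Lemma sqr_pdf_le x : (1 + x ^+ 2) * pdf x <= (3 * normal_peak 1 / normal_peak 2) * normal_pdf 0 2 x.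
Proof.
have p2 : 0 < normal_peak 2 :> R by apply: normal_peak_gt0; rewrite pnatr_eq0.
rewrite pdfE (@normal_pdfE _ 0 2) ?pnatr_eq0 // /normal_fun subr0.
have key : (1 + x ^+ 2) * expR (- (x ^+ 2 / 2)) <= 3 * expR (- x ^+ 2 / (2 ^+ 2 *+ 2)).
  have -> : - (x ^+ 2 / 2) = - x ^+ 2 / (2 ^+ 2 *+ 2) - 3 / 8 * x ^+ 2 :> R.
    by rewrite -[2 ^+ 2 *+ 2]mulr_natl; field.
  rewrite expRD mulrCA [X in _ <= X]mulrC ler_wpM2l ?expR_ge0 //.
  rewrite expRN ler_pdivrMr ?expR_gt0 //.
  have := expR_ge1Dx (3 / 8 * x ^+ 2); have := sqr_ge0 x; lra.
set u := expR _ in key *; set v := expR _ in key *.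
have -> : 3 * normal_peak 1 / normal_peak 2 * (normal_peak 2 * v) = normal_peak 1 * (3 * v) :> R.
  by field; rewrite gt_eqF.
by rewrite mulrCA ler_wpM2l // normal_peak_ge0.
Qed.

Lemma gint_integrable f : gint f -> mu.-integrable setT (EFin \o (fun x => f x * pdf x)).
Proof.
move=> [mf [C hC]].
have C0 : 0 <= C.
  by have := le_trans (normr_ge0 _) (hC 0); rewrite expr0n addr0 mulr1.
apply: (@le_integrable _ _ _ mu _ _ _
   (fun x => (C * (3 * normal_peak 1 / normal_peak 2))%:E * (normal_pdf 0 2 x)%:E)%E) => //.
- by apply/measurable_EFinP; apply: measurable_funM => //; exact: measurable_normal_pdf.
- move=> x _ /=; rewrite lee_fin normrM (ger0_norm (pdf_ge0 x)).
  apply: (@le_trans _ _ (C * (1 + x ^+ 2) * pdf x)); first by rewrite ler_wpM2r // pdf_ge0.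
  rewrite -mulrA (le_trans (ler_wpM2l C0 (sqr_pdf_le x))) // mulrA; exact: ler_norm.
- by apply: integrableZl => //; exact: integrable_normal_pdf.
Qed.

Lemma gint_bounded (f : R -> R) (C : R) : measurable_fun [set: R] f -> (forall x, `|f x| <= C) -> gint f.
Proof.
move=> mf hC; split => //; exists C => x; rewrite (le_trans (hC x)) //.
by rewrite ler_peMr ?lerDl ?sqr_ge0 //; exact: le_trans (normr_ge0 _) (hC 0).
Qed.

Lemma gint_add f g : gint f -> gint g -> gint (fun x => f x + g x).
Proof.
move=> [mf [C hC]] [mg [D hD]]; split; first exact: measurable_funD.
by exists (C + D) => x; rewrite (le_trans (ler_normD _ _)) // mulrDl lerD.
Qed.

Lemma gint_scale c f : gint f -> gint (fun x => c * f x).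
Proof.
move=> [mf [C hC]]; split; first by apply: measurable_funM.
by exists (`|c| * C) => x; rewrite normrM -mulrA ler_wpM2l.
Qed.

Lemma gint_norm f : gint f -> gint (fun x => `|f x|).
Proof.
move=> [mf [C hC]]; split; first exact: measurableT_comp.
by exists C => x; rewrite normr_id.
Qed.

Lemma gint_mulx (f : R -> R) (C : R) : measurable_fun [set: R] f -> (forall x, `|f x| <= C) ->
  gint (fun x => x * f x).
Proof.
move=> mf hC; split; first by apply: measurable_funM.
exists C => x; rewrite normrM mulrC ler_pM //.
by rewrite -(real_normK (num_real x)); have := sqr_ge0 (`|x| - 1); nra.
Qed.

Lemma gint_sqr : gint (fun x => x ^+ 2).
Proof.
split; first exact: measurable_funX.
by exists 1 => x; rewrite ger0_norm ?sqr_ge0 // mul1r lerDr.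
Qed.

Lemma gexpD f g : gint f -> gint g -> gexp (fun x => f x + g x) = gexp f + gexp g.
Proof.
move=> gf gg; rewrite /gexp; under eq_Rintegral do rewrite mulrDl.
by rewrite RintegralD //; exact: gint_integrable.
Qed.

Lemma gexpZ c f : gint f -> gexp (fun x => c * f x) = c * gexp f.
Proof.
move=> gf; rewrite /gexp; under eq_Rintegral do rewrite -mulrA.
by rewrite RintegralZl //; exact: gint_integrable.
Qed.

Lemma le_gexp f g : gint f -> gint g -> (forall x, f x <= g x) -> gexp f <= gexp g.
Proof.
move=> gf gg fg; apply: le_Rintegral => //; try exact: gint_integrable.
by move=> x _; rewrite ler_wpM2r // pdf_ge0.
Qed.

Lemma gexp_cst c : gexp (fun=> c) = c.
Proof.
rewrite /gexp RintegralZl //; last exact: integrable_normal_pdf.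
by rewrite /Rintegral integral_normal_pdf mulr1.
Qed.

Lemma gint_cst c : gint (fun=> c).
Proof. by apply: (@gint_bounded _ `|c|). Qed.

Lemma ler_norm_gexp f : gint f -> `|gexp f| <= gexp (fun x => `|f x|).
Proof.
move=> gf; apply: (le_trans (le_normr_Rintegral _ (gint_integrable gf))) => //.
rewrite le_eqVlt; apply/orP; left; apply/eqP; apply: eq_Rintegral => x _.
by rewrite normrM (ger0_norm (pdf_ge0 x)).
Qed.

(** The Radon-Nikodym derivative of the normal law agrees almost everywhere with its density, having
    the same integrals over measurable sets. *)
Lemma normal_RintegralE (f : R -> R) (C : R) : measurable_fun [set: R] f -> (forall x, `|f x| <= C) ->
  Rintegral (normal_prob 0 1) setT f = gexp f.
Proof.
move=> mf hC.
have dom := @normal_prob_dominates R 0 1.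
have fi : (normal_prob 0 1).-integrable setT (EFin \o f).
  apply: measurable_bounded_integrable => //.
  - by have := @probability_setT _ _ _ (normal_prob (0 : R) 1) => /= ->; rewrite ltry.
  - exists C; split; first exact: num_real.
    by move=> K CK x _; exact: le_trans (hC x) (ltW CK).
congr fine.
rewrite -(Radon_Nikodym_change_of_variables dom) //=.
apply: ae_eq_integral => //.
- apply: emeasurable_funM; first exact/measurable_EFinP.
  apply: (measurable_int mu); exact: Radon_Nikodym_integrable.
- by apply/measurable_EFinP; apply: measurable_funM => //; exact: measurable_normal_pdf.
under [X in ae_eq _ _ _ X]eq_fun do rewrite EFinM.
apply: ae_eqe_mul2l => /=.
apply: integral_ae_eq => //=.
- exact: Radon_Nikodym_integrable.
- by apply/measurable_EFinP; exact: measurable_normal_pdf.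
- by move=> E _ mE; rewrite -Radon_Nikodym_integral.
Qed.

End gauss.

Section gauss_char.
Variable R : realType.
Local Notation mu := (@lebesgue_measure R).
Local Notation pdf := (@normal_pdf R 0 1).

Lemma continuous_affine (t b : R) : continuous (fun x : R => t * x + b).
Proof.
move=> x; apply: cvgD; last exact: cvg_cst.
by apply: cvgMl_tmp; exact: cvg_id.
Qed.

Lemma measurable_affine_comp (h : R -> R) (t b : R) : continuous h ->
  measurable_fun [set: R] (fun x => h (t * x + b)).
Proof.
move=> ch; apply: continuous_measurable_fun => x.
by apply: continuous_comp; [exact: continuous_affine|exact: ch].
Qed.

Lemma cos_le1_norm (x : R) : `|cos x| <= 1.
Proof. by rewrite ler_norml cos_geN1 cos_le1. Qed.

Lemma sin_le1_norm (x : R) : `|sin x| <= 1.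
Proof. by rewrite ler_norml sin_geN1 sin_le1. Qed.

Lemma gint_cos (t b : R) : gint (fun x => cos (t * x + b)).
Proof.
apply: (@gint_bounded _ _ 1) => [|x]; last exact: cos_le1_norm.
by apply: measurable_affine_comp; exact: continuous_cos.
Qed.

Lemma gint_xsin (t b : R) : gint (fun x => x * sin (t * x + b)).
Proof.
apply: (@gint_mulx _ _ 1) => [|x]; last exact: sin_le1_norm.
by apply: measurable_affine_comp; exact: continuous_sin.
Qed.

Lemma is_derive_affine (t b x : R) : is_derive x 1 (fun x : R => t * x + b) t.
Proof.
have -> : (fun x : R => t * x + b) = t \*: id + cst b by [].
by apply: is_derive_eq; rewrite /GRing.scale /= mulr1 addr0.
Qed.

Lemma is_derive_pdf (x : R) : is_derive x 1 pdf (- x * pdf x).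
Proof.
rewrite pdfE; have -> : pdf = normal_peak 1 \*: (expR \o (fun y : R => - (y ^+ 2 / 2))).
  by apply/funext => y; rewrite pdfE.
have d : is_derive x 1 (fun y : R => - (y ^+ 2 / 2)) (- x).
  have -> : (fun y : R => - (y ^+ 2 / 2)) = - 2^-1 \*: (id ^+ 2).
    by apply/funext => y /=; rewrite /GRing.scale /= mulNr mulrC.
  by apply: is_derive_eq; rewrite /GRing.scale /= expr1 mulr1; field.
apply: is_derive_eq; rewrite /GRing.scale /=; ring.
Qed.

(** Integration of the derivative of [sin (t x + b) * pdf x] over growing intervals: boundary terms
    vanish, and dominated convergence gives the integral over the line. *)
Lemma gauss_stein (t b : R) :
  gexp (fun x => x * sin (t * x + b)) = t * gexp (fun x => cos (t * x + b)).
Proof.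
pose g (x : R) := t * cos (t * x + b) + (- 1) * (x * sin (t * x + b)).
have gg : gint g.
  by apply: gint_add; apply: gint_scale; [exact: gint_cos|exact: gint_xsin].
suff : gexp g = 0.
  rewrite /g gexpD; [|exact/gint_scale/gint_cos|exact/gint_scale/gint_xsin].
  rewrite !gexpZ; [|exact: gint_xsin|exact: gint_cos].
  by rewrite mulN1r => /eqP; rewrite subr_eq0 => /eqP.
pose F (x : R) := sin (t * x + b) * pdf x.
have dF (x : R) : is_derive x 1 F (g x * pdf x).
  have d1 : is_derive x 1 (sin \o (fun y : R => t * y + b)) (t * cos (t * x + b)).
    have h := is_derive_affine t b x.
    by apply: is_derive_eq; rewrite /GRing.scale /=; ring.
  have d2 := is_derive_pdf x.
  have -> : F = (sin \o (fun y : R => t * y + b)) * pdf by [].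
  by apply: is_derive_eq; rewrite /GRing.scale /= /g; ring.
have cF : continuous F.
  by move=> x; apply: differentiable_continuous; apply/derivable1_diffP;
    exact: (@ex_derive _ _ _ _ _ _ _ (dF x)).
have cg : continuous (fun x => g x * pdf x).
  move=> x; apply: cvgM; last exact: continuous_normal_pdf.
  apply: cvgD; apply: cvgMl_tmp.
    by apply: continuous_comp; [exact: continuous_affine|exact: continuous_cos].
  apply: cvgM; first exact: cvg_id.
  by apply: continuous_comp; [exact: continuous_affine|exact: continuous_sin].
(* The successor keeps the interval nondegenerate when [n = 0]. *)
have ftc (n : nat) : (\int[mu]_(x in `[(- n.+1%:R)%R, n.+1%:R]) (g x * pdf x)%:E =
    (F n.+1%:R - F (- n.+1%:R))%:E)%E.
  have lt : - n.+1%:R < n.+1%:R :> R by rewrite -subr_gt0 opprK addr_gt0.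
  rewrite (@continuous_FTC2 _ (fun x => g x * pdf x) F) //.
  - exact: continuous_subspaceT.
  - split.
    + by move=> x _; exact: (@ex_derive _ _ _ _ _ _ _ (dF x)).
    + by apply: cvg_at_right_filter; exact: cF.
    + by apply: cvg_at_left_filter; exact: cF.
  - by move=> x _; rewrite derive1E; exact: (@derive_val _ _ _ _ _ _ _ (dF x)).
have pdf0 : pdf n.+1%:R @[n --> \oo] --> (0 : R).
  apply/cvgrPdist_le => e e0; near=> n; rewrite sub0r normrN ger0_norm ?pdf_ge0 //.
  have n0 : (0 : R) < n.+1%:R by [].
  have := sqr_pdf_le (n.+1%:R : R); set c := 3 * _ / _.
  have c0 : 0 <= c by rewrite !mulr_ge0 ?invr_ge0 ?normal_peak_ge0.
  have p2 : normal_pdf 0 2 n.+1%:R <= normal_peak 2 :> R by apply: normal_pdf_ub; rewrite pnatr_eq0.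
  have p20 : 0 <= normal_peak 2 :> R by exact: normal_peak_ge0.
  have en : c * normal_peak 2 <= e * n.+1%:R.
    rewrite -ler_pdivrMl // mulrC; apply: (@le_trans _ _ n%:R); last by rewrite ler_nat.
    near: n; exact: nbhs_infty_ger.
  have n1 : n.+1%:R <= n.+1%:R ^+ 2 :> R by rewrite expr2 ler_peMr // ler1n.
  move=> h; have h2 : n.+1%:R * pdf n.+1%:R <= c * normal_peak 2.
    apply: (@le_trans _ _ ((1 + n.+1%:R ^+ 2) * pdf n.+1%:R)).
      by rewrite ler_wpM2r ?pdf_ge0 // ler_wpDl.
    by apply: (le_trans h); rewrite ler_wpM2l.
  by rewrite -(ler_pM2l n0) (le_trans h2) // [X in _ <= X]mulrC.
have pdfN (x : R) : pdf (- x) = pdf x by rewrite !pdfE sqrrN.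
have lim0 : (F n.+1%:R - F (- n.+1%:R)) @[n --> \oo] --> (0 : R).
  apply/cvgrPdist_le => e e0.
  have e2 : 0 < e / 2 by rewrite divr_gt0.
  move/cvgrPdist_le: pdf0 => /(_ _ e2) H; near=> n.
  have : `|0 - pdf n.+1%:R| <= e / 2 by near: n.
  rewrite !sub0r !normrN ger0_norm ?pdf_ge0 // => hp.
  rewrite (le_trans (ler_normB _ _)) // /F !normrM pdfN (ger0_norm (pdf_ge0 _)) (splitr e).
  by apply: lerD; rewrite (le_trans _ hp) // ler_piMl ?pdf_ge0 // sin_le1_norm.
have gi := gint_integrable gg.
pose fn (n : nat) : R -> \bar R := (EFin \o (fun x => g x * pdf x)) \_ `[(- n.+1%:R)%R, n.+1%:R].
have h1 n : measurable_fun [set: R] (fn n).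
  apply/(measurable_restrictT _ _).1 => //.
  by apply: measurable_funTS; exact: (measurable_int mu gi).
have h2 := measurable_int mu gi.
have h3 : {ae mu, forall x, [set: R] x ->
    fn ^~ x @ \oo --> (EFin \o (fun x => g x * pdf x)) x}.
  apply: aeW => x _; apply: cvg_near_cst; near=> n.
  rewrite /fn patchE ifT // inE /= in_itv /= -ler_norml.
  apply: (@le_trans _ _ n%:R); last by rewrite ler_nat.
  near: n; exact: nbhs_infty_ger.
have h4 := integrable_abse gi.
have h5 : {ae mu, forall x n, [set: R] x ->
    (`|fn n x| <= (abse \o (EFin \o (fun x => (g x * pdf x)%R))) x)%E}.
  apply: aeW => x n _; rewrite /fn patchE; case: ifP => // _.
  by rewrite abse0 abse_ge0.
have [|||||_ _] := @dominated_convergence _ _ R mu setT measurableT fn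
  (EFin \o (fun x => g x * pdf x)) (abse \o (EFin \o (fun x => g x * pdf x))).
- exact: h1.
- exact: h2.
- exact: h3.
- exact: h4.
- exact: h5.
move=> c1.
have e : [sequence (\int[mu]_x fn n x)%E]_n = (fun n => (F n.+1%:R - F (- n.+1%:R))%:E).
  by apply/funext => n; rewrite /= -ftc [RHS]integral_mkcond.
rewrite e in c1.
have c2 : (F n.+1%:R - F (- n.+1%:R))%:E @[n --> \oo] --> 0%:E.
  by apply: cvg_EFin => //; near=> n.
by rewrite /gexp /Rintegral -(cvg_unique _ c2 c1).
Unshelve. all: by end_near. Qed.

Lemma gauss_char (t b : R) : gexp (fun x => cos (t * x + b)) = expR (- (t ^+ 2 / 2)) * cos b.
Proof.
pose c (u : R) := gexp (fun x => cos (u * x + b)).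
pose dc (u : R) := (- 1) * gexp (fun x => x * sin (u * x + b)).
have c0 : c 0 = cos b.
  by rewrite /c; under eq_fun do rewrite mul0r add0r; exact: gexp_cst.
have dcP (u : R) : is_derive u 1 c (dc u).
  apply: (@is_derive_quadratic _ _ _ _ (2 * gexp (fun x => x ^+ 2))) => h.
  have g1 := gint_cos (u + h) b; have g2 := gint_cos u b; have g3 := gint_xsin u b.
  have -> : c (u + h) - c u - h * dc u = gexp (fun x => (cos ((u + h) * x + b) +
     (- 1) * cos (u * x + b)) + h * (x * sin (u * x + b))).
    rewrite !gexpD ?gexpZ /c /dc //; do ?[done|apply: gint_scale|apply: gint_add].
    by ring.
  have nn : gint (fun x => (cos ((u + h) * x + b) +
     (- 1) * cos (u * x + b)) + h * (x * sin (u * x + b))).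
    by do ?[done|apply: gint_scale|apply: gint_add].
  apply: (le_trans (ler_norm_gexp nn)).
  rewrite mulrAC -gexpZ; last exact: gint_sqr.
  apply: le_gexp; [exact: gint_norm|exact/gint_scale/gint_sqr|].
  move=> x; have := cos_add_le (u * x + b) (h * x).
  have -> : u * x + b + h * x = (u + h) * x + b by ring.
  by rewrite mulN1r exprMn !mulrA.
(* Here Stein's identity is exact, so the error parameter is [0] and the inequality becomes an
   equality. *)
have := @gauss_ode R c dc 1 0 _ (lexx 0) dcP _ t.
rewrite ler01 lexx c0 mulr0 normr_le0 subr_eq0 => h; apply/eqP.
have -> : t ^+ 2 / 2 = 1 / 2 * t ^+ 2 by rewrite mul1r mulrC.
apply: h => // u _.
by rewrite /dc gauss_stein /c mulN1r mul1r addNr normr0 mulr0.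
Qed.

End gauss_char.

(** * Trigonometric approximation *)

Section bernstein.
Variable R : realType.

(* The expectation of [h] under the binomial law of parameters [m] and [y], by
   conditioning on the first trial. *)
Fixpoint bern (m : nat) (h : nat -> R) (y : R) : R :=
  if m is m'.+1 then y * bern m' (fun k => h k.+1) y + (1 - y) * bern m' h y else h 0%N.

Lemma bern_lin m (c d : R) (g h : nat -> R) y :
  bern m (fun k => c * g k + d * h k) y = c * bern m g y + d * bern m h y.
Proof. by elim: m g h => [//|m ih] g h /=; rewrite !ih; ring. Qed.

Lemma bern_cst m (c : R) y : bern m (fun=> c) y = c.
Proof. by elim: m => [//|m ih] /=; rewrite ih; ring. Qed.

Lemma le_bern m (g h : nat -> R) y : 0 <= y <= 1 -> (forall k, g k <= h k) ->
  bern m g y <= bern m h y.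
Proof.
move=> /andP[y0 y1]; elim: m g h => [|m ih] g h gh /=; first exact: gh.
by apply: lerD; apply: ler_wpM2l; rewrite ?subr_ge0 //; apply: ih.
Qed.

Lemma eq_bern m (g h : nat -> R) y : g =1 h -> bern m g y = bern m h y.
Proof. by move=> /funext ->. Qed.

(** Squared bias plus variance. The centre is arbitrary because one success in the first trial
    shifts it by one in the induction. *)
Lemma bern_sqr m (c : R) y :
  bern m (fun k => (k%:R - c) ^+ 2) y = (m%:R * y - c) ^+ 2 + m%:R * y * (1 - y).
Proof.
elim: m c => [|m ih] c /=; first by ring.
rewrite (@eq_bern _ _ (fun k => (k%:R - (c - 1)) ^+ 2)) => [|k]; last first.
  by rewrite -natr1; ring.
by rewrite !ih -natr1; ring.
Qed.

(** Only [x] is confined to the interval: the nodes [k / m] are compared for every natural [k]. *)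
Lemma uniform_continuity_itv (F : R -> R) (a b e : R) : continuous F -> 0 < e ->
  exists2 d : R, 0 < d & forall x y, a <= x <= b -> `|x - y| < d -> `|F x - F y| <= e.
Proof.
move=> cF e0.
have /compact_near_coveringP cov := @segment_compact R a b.
have e2 : 0 < e / 2 by rewrite divr_gt0.
have near_pt x : `[a, b]%classic x -> \forall x' \near x & d \near (0 : R)^'+,
    forall y, `|x' - y| < d -> `|F x' - F y| <= e.
  move=> _; have /cvgrPdist_lt/(_ _ e2) := cF x.
  move=> /nbhs_ballP[r r0 hr].
  have r2 : 0 < r / 2 by rewrite divr_gt0.
  exists (ball x (r / 2), [set d | 0 < d < r / 2]).
    split; first exact: nbhsx_ballx.
    near=> d; apply/andP; split; near: d; first exact: nbhs_right_gt.
    by apply: nbhs_right_lt.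
  move=> [x' d] /= [bx /andP[d0 dr]] y xy.
  have h1 : `|F x - F x'| < e / 2 by apply: hr; apply: lt_trans bx _; rewrite ltr_pdivrMr // ltr_pMr // ltr1n.
  have h2 : `|F x - F y| < e / 2.
    apply: hr; rewrite /ball /= (splitr r).
    have -> : x - y = (x - x') + (x' - y) by ring.
    by apply: (le_lt_trans (ler_normD _ _)); apply: ltrD => //; exact: lt_trans dr.
  have -> : F x' - F y = (F x - F y) - (F x - F x') by ring.
  by apply: (le_trans (ler_normB _ _)); rewrite (splitr e); apply: lerD; exact: ltW.
have := cov _ ((0 : R)^'+) _ _ near_pt.
move=> H; near (0 : R)^'+ => d; exists d; first by near: d; exact: nbhs_right_gt.
move=> x y xab xy.
have h : `[a, b]%classic `<=` [set x' | forall y, `|x' - y| < d -> `|F x' - F y| <= e].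
  by near: d; exact: H.
by apply: (h x) => //=; rewrite in_itv.
Unshelve. all: by end_near. Qed.

Lemma bernstein_approx (H : R -> R) (C e : R) : continuous H -> (forall x, `|H x| <= C) ->
  0 < e -> exists2 h : nat -> R, (forall k, `|h k| <= C) &
    exists m, forall y, 0 <= y <= 1 -> `|H y - bern m h y| <= e.
Proof.
move=> cH hC e0; have C0 : 0 <= C := le_trans (normr_ge0 _) (hC 0).
have e2 : 0 < e / 2 by rewrite divr_gt0.
have [d d0 hd] := uniform_continuity_itv 0 1 cH e2.
near \oo => m.
have m0 : (0 < m)%N by near: m; exact: nbhs_infty_gt.
have mR : 0 < m%:R :> R by rewrite ltr0n.
exists (fun k => H (k%:R / m%:R)) => //; exists m => y y01.
(* Chebyshev's argument: at distance at least [d] the trivial bound [2 C] is at most [K] times the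
   squared distance. *)
pose K := 2 * C / d ^+ 2.
have K0 : 0 <= K by rewrite divr_ge0 ?sqr_ge0 // mulr_ge0.
have pt k : `|H y - H (k%:R / m%:R)| <= e / 2 + K / m%:R ^+ 2 * (k%:R - m%:R * y) ^+ 2.
  have -> : K / m%:R ^+ 2 * (k%:R - m%:R * y) ^+ 2 = K * (y - k%:R / m%:R) ^+ 2.
    by field; rewrite gt_eqF.
  have [yd|yd] := ltP `|y - k%:R / m%:R| d.
    by rewrite ler_wpDr ?hd // mulr_ge0 // sqr_ge0.
  rewrite ler_wpDl ?(ltW e2) // (le_trans (ler_normB _ _)) //.
  apply: (@le_trans _ _ (2 * C)); first by have := hC y; have := hC (k%:R / m%:R); lra.
  rewrite /K -mulrA ler_peMr ?mulr_ge0 // mulrC ler_pdivlMr ?exprn_gt0 // mul1r.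
  by rewrite -[X in _ <= X]real_normK ?num_real // ler_pXn2r ?nnegrE ?(ltW d0).
have lin : H y - bern m (fun k => H (k%:R / m%:R)) y =
    bern m (fun k => 1 * (H y) + (- 1) * H (k%:R / m%:R)) y.
  by rewrite (bern_lin m 1 (-1) (fun=> H y)) bern_cst mul1r mulN1r.
have Kb : bern m (fun k => 1 * (e / 2) + K / m%:R ^+ 2 * (k%:R - m%:R * y) ^+ 2) y <= e.
  rewrite (bern_lin m 1 _ (fun=> e / 2)) bern_cst bern_sqr subrr expr0n add0r mul1r [X in _ <= X](splitr e).
  rewrite lerD2l.
  apply: (@le_trans _ _ (K / m%:R)).
    have -> : K / m%:R ^+ 2 * (m%:R * y * (1 - y)) = K / m%:R * (y * (1 - y)).
      by field; rewrite gt_eqF.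
    rewrite ler_piMr ?divr_ge0 //; case/andP: y01; nra.
  rewrite ler_pdivrMr // mulrC -ler_pdivrMr //; near: m; exact: nbhs_infty_ger.
rewrite lin ler_norml; apply/andP; split.
  rewrite lerNl; apply: le_trans Kb.
  have -> : - bern m (fun k => 1 * (H y) + (- 1) * H (k%:R / m%:R)) y =
     bern m (fun k => (- 1) * (H y) + 1 * H (k%:R / m%:R)) y.
    rewrite (bern_lin m 1 (-1) (fun=> H y)) (bern_lin m (-1) 1 (fun=> H y)); ring.
  apply: le_bern => // k; rewrite mulN1r !mul1r; move: (pt k).
  by rewrite ler_norml => /andP[+ _]; lra.
apply: le_trans Kb; apply: le_bern => // k; rewrite mulN1r !mul1r; move: (pt k).
by rewrite ler_norml => /andP[_].
Unshelve. all: by end_near. Qed.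

Lemma bern_bound m (h : nat -> R) (C y : R) : 0 <= y <= 1 -> (forall k, `|h k| <= C) ->
  `|bern m h y| <= C.
Proof.
move=> y01 hC; rewrite ler_norml; apply/andP; split.
  by rewrite -[X in X <= _](bern_cst m _ y); apply: le_bern => // k; move: (hC k); rewrite ler_norml => /andP[].
by rewrite -[X in _ <= X](bern_cst m _ y); apply: le_bern => // k; move: (hC k); rewrite ler_norml => /andP[].
Qed.

End bernstein.

Section trig_polynomials.
Variable R : realType.

Definition trig_poly (s : seq (R * R * R)) (x : R) : R :=
  \sum_(p <- s) p.1.1 * cos (p.1.2 * x + p.2).

Definition is_trig (q : R -> R) := exists s, q = trig_poly s.

Lemma is_trig_add q r : is_trig q -> is_trig r -> is_trig (fun x => q x + r x).
Proof.
move=> [s ->] [t ->]; exists (s ++ t); apply/funext => x.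
by rewrite /trig_poly big_cat.
Qed.

Lemma is_trig_scale c q : is_trig q -> is_trig (fun x => c * q x).
Proof.
move=> [s ->]; exists [seq ((c * p.1.1, p.1.2), p.2) | p <- s]; apply/funext => x.
by rewrite /trig_poly big_map mulr_sumr; apply: eq_bigr => p _; rewrite mulrA.
Qed.

Lemma is_trig_cos (t b : R) : is_trig (fun x => cos (t * x + b)).
Proof.
by exists [:: ((1, t), b)]; apply/funext => x; rewrite /trig_poly big_seq1 mul1r.
Qed.

Lemma is_trig_cst (c : R) : is_trig (fun=> c).
Proof.
have -> : (fun _ : R => c) = (fun x => c * cos (0 * x + 0)).
  by apply/funext => x; rewrite mul0r addr0 cos0 mulr1.
exact/is_trig_scale/is_trig_cos.
Qed.

Lemma cos_mul_cos (u v : R) : cos u * cos v = 2^-1 * cos (u + v) + 2^-1 * cos (u - v).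
Proof. by rewrite cosD cosB; field. Qed.

Lemma is_trig_mul_cos q (t b : R) : is_trig q -> is_trig (fun x => q x * cos (t * x + b)).
Proof.
move=> [s ->]; elim: s => [|p s ih].
  have -> : (fun x => trig_poly [::] x * cos (t * x + b)) = (fun=> 0).
    by apply/funext => x; rewrite /trig_poly big_nil mul0r.
  exact: is_trig_cst.
have -> : (fun x => trig_poly (p :: s) x * cos (t * x + b)) =
   (fun x => p.1.1 * (2^-1 * cos ((p.1.2 + t) * x + (p.2 + b)) +
      2^-1 * cos ((p.1.2 - t) * x + (p.2 - b))) + trig_poly s x * cos (t * x + b)).
  apply/funext => x; rewrite /trig_poly big_cons mulrDl; congr (_ + _).
  rewrite -mulrA cos_mul_cos; congr (_ * (_ * cos _ + _ * cos _)); ring.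
apply: is_trig_add => //; apply: is_trig_scale.
by apply: is_trig_add; apply: is_trig_scale; exact: is_trig_cos.
Qed.

Lemma is_trig_mul q r : is_trig q -> is_trig r -> is_trig (fun x => q x * r x).
Proof.
move=> tq [s ->]; elim: s => [|p s ih].
  have -> : (fun x => q x * trig_poly [::] x) = (fun=> 0).
    by apply/funext => x; rewrite /trig_poly big_nil mulr0.
  exact: is_trig_cst.
have -> : (fun x => q x * trig_poly (p :: s) x) =
   (fun x => p.1.1 * (q x * cos (p.1.2 * x + p.2)) + q x * trig_poly s x).
  by apply/funext => x; rewrite /trig_poly big_cons mulrDr mulrCA.
by apply: is_trig_add => //; apply: is_trig_scale; exact: is_trig_mul_cos.
Qed.

Lemma is_trig_bern m (h : nat -> R) (y : R -> R) : is_trig y -> is_trig (fun x => bern m h (y x)).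
Proof.
move=> ty; elim: m h => [|m ih] h /=; first exact: is_trig_cst.
apply: is_trig_add; apply: is_trig_mul => //.
have -> : (fun x => 1 - y x) = (fun x => 1 + (- 1) * y x).
  by apply/funext => x; rewrite mulN1r.
by apply: is_trig_add; [exact: is_trig_cst|exact: is_trig_scale].
Qed.

(* On [-L, L] the function [x |-> sin (x / 2L)] is injective with values in [-1/2, 1/2], so
   [f] factors there through it, and a Bernstein polynomial in it is a trigonometric one. *)
Lemma trig_approx (f : R -> R) (C L e : R) : continuous f -> (forall x, `|f x| <= C) ->
  0 < L -> 0 < e -> exists q, [/\ is_trig q, forall x, `|q x| <= C &
    forall x, `|x| <= L -> `|f x - q x| <= e].
Proof.
move=> cf hC L0 e0.
pose a : R := (2 * L)^-1.
have a0 : 0 < a by rewrite invr_gt0 mulr_gt0.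
(* Truncation to [[-1/2, 1/2]], which keeps the argument of [asin] inside its open domain and makes
   [H] continuous on the whole line. *)
pose clamp (v : R) := (`|v + 2^-1| - `|v - 2^-1|) * 2^-1.
have clampP v : - 2^-1 <= clamp v <= 2^-1.
  rewrite /clamp; case: (ger0P (v + 2^-1)) => ?; case: (ger0P (v - 2^-1)) => ?;
    apply/andP; split; lra.
have clamp_id v : `|v| <= 2^-1 -> clamp v = v.
  rewrite ler_norml => /andP[v1 v2]; rewrite /clamp ger0_norm ?ler0_norm; first field; lra.
have cclamp : continuous clamp.
  move=> v; apply: cvgMr_tmp; apply: cvgB; apply: cvg_norm;
  [apply: cvgD|apply: cvgB]; by [exact: cvg_id|exact: cvg_cst].
have casin : continuous (fun v => asin (clamp v)).
  move=> v; apply: continuous_comp; first exact: cclamp.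
  by apply: continuous_asin; have /andP[? ?] := clampP v; lra.
pose H y := f (asin (clamp (2 * y - 1)) / a).
have cH : continuous H.
  have caff : continuous (fun y : R => 2 * y - 1).
    by move=> y; apply: cvgB; [apply: cvgMl_tmp; exact: cvg_id|exact: cvg_cst].
  have c2 : continuous ((fun v => asin (clamp v)) \o (fun y : R => 2 * y - 1)).
    by move=> y; apply: continuous_comp; [exact: caff|exact: casin].
  have c3 : continuous (fun y : R => asin (clamp (2 * y - 1)) / a).
    by move=> y; apply: cvgMr_tmp; exact: c2.
  have -> : H = f \o (fun y : R => asin (clamp (2 * y - 1)) / a) by [].
  by move=> y; apply: continuous_comp; [exact: c3|exact: cf].
have [h hh [m hm]] := bernstein_approx cH (fun y => hC _) e0.
pose y (x : R) := 2^-1 * (1 + sin (a * x)).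
have y01 x : 0 <= y x <= 1.
  by rewrite /y; have := sin_geN1 (a * x); have := sin_le1 (a * x) => ? ?; apply/andP; split; lra.
have ty : is_trig y.
  have -> : y = (fun x => 2^-1 * (1 + cos (a * x + (- (pi / 2))))).
    by apply/funext => x; rewrite /y cosB cos_pihalf sin_pihalf mulr0 mulr1 add0r.
  by apply: is_trig_scale; apply: is_trig_add; [exact: is_trig_cst|exact: is_trig_cos].
exists (fun x => bern m h (y x)); split.
- exact: is_trig_bern.
- by move=> x; exact: bern_bound.
move=> x xL; have := hm (y x) (y01 x).
have ax : `|a * x| <= 2^-1.
  rewrite normrM (gtr0_norm a0) (le_trans (ler_wpM2l (ltW a0) xL)) //.
  by rewrite /a invfM -mulrA mulVf ?mulr1 // gt_eqF.
have -> : H (y x) = f x => //.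
rewrite /H /y mulrA divff ?pnatr_eq0 // mul1r addrC addKr clamp_id; last first.
  exact: le_trans (sin_abs_le _) ax.
rewrite sinK ?(mulrC a) ?mulfK ?gt_eqF // in_itv /=.
have := @pi_ge2 R => p2; move: ax; rewrite mulrC ler_norml => /andP[? ?]; apply/andP; split; lra.
Qed.

End trig_polynomials.

(** * Convergence in law *)

Section limit_law.
Variables (R : realType) (s : R).
Hypothesis s1 : s ^+ 2 <= 1.
Local Notation sg := (Num.sqrt (1 - s ^+ 2)).

Definition bcont (f : R -> R) := continuous f /\ exists C : R, forall x, `|f x| <= C.

Lemma bcont_cos (t b : R) : bcont (fun x => cos (t * x + b)).
Proof.
split; last by exists 1 => x; exact: cos_le1_norm.
by move=> x; apply: continuous_comp; [exact: continuous_affine|exact: continuous_cos].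
Qed.

Lemma bcont_lin c f g : bcont f -> bcont g -> bcont (fun x => c * f x + g x).
Proof.
move=> [cf [C hC]] [cg [D hD]]; split.
  by move=> x; apply: cvgD; [apply: cvgMl_tmp; exact: cf|exact: cg].
exists (`|c| * C + D) => x; rewrite (le_trans (ler_normD _ _)) // lerD // normrM ler_wpM2l //.
Qed.

Lemma bcont_trig q : is_trig q -> bcont q.
Proof.
move=> [l ->]; elim: l => [|p l ih].
  have -> : trig_poly [::] = (fun _ : R => 0).
    by apply/funext => x; rewrite /trig_poly big_nil.
  by split; [move=> x; exact: cvg_cst|exists 0 => x; rewrite normr0].
have -> : trig_poly (p :: l) = (fun x => p.1.1 * cos (p.1.2 * x + p.2) + trig_poly l x).
  by apply/funext => x; rewrite /trig_poly big_cons.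
by apply: bcont_lin => //; exact: bcont_cos.
Qed.

(** The expectation of [f (Z + s Y)] given [Y = k]. *)
Definition gshift (f : R -> R) (k : nat) : R := gexp (fun x => f (sg * x + s * k%:R)).

Lemma gint_shift f k : bcont f -> gint (fun x => f (sg * x + s * k%:R)).
Proof.
move=> [cf [C hC]]; apply: (@gint_bounded _ _ C) => [|x]; last exact: hC.
exact: measurable_affine_comp.
Qed.

Lemma gshift_bound f (C : R) : continuous f -> (forall x, `|f x| <= C) -> forall k, `|gshift f k| <= C.
Proof.
move=> cf hC k; have bf : bcont f by split => //; exists C.
apply: (le_trans (ler_norm_gexp (gint_shift k bf))).
rewrite -[X in _ <= X]gexp_cst; apply: le_gexp; [exact/gint_norm/gint_shift|exact: gint_cst|].
by move=> x; exact: hC.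
Qed.

Lemma expect_ZsYE f : bcont f ->
  expect_ZsY s f = limn (series (fun k => poisson_pmf 1 k * gshift f k)).
Proof.
move=> [cf [C hC]]; rewrite /expect_ZsY; congr (lim (_ @ \oo)); apply/funext => m.
rewrite /series /=; apply: eq_bigr => k _; congr (_ * _).
rewrite (@normal_RintegralE _ _ C) //; exact: measurable_affine_comp.
Qed.

Lemma cvg_ZsY f : bcont f ->
  series (fun k => poisson_pmf 1 k * gshift f k) @ \oo --> expect_ZsY s f.
Proof.
move=> bf; rewrite expect_ZsYE //; case: bf => cf [C hC].
exact: (is_cvg_poisson_series (gshift_bound cf hC)).
Qed.

Lemma expect_ZsY_lin c f g : bcont f -> bcont g ->
  expect_ZsY s (fun x => c * f x + g x) = c * expect_ZsY s f + expect_ZsY s g.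
Proof.
move=> bf bg.
have h1 := cvg_ZsY (bcont_lin c bf bg).
have h2 : (fun n => c * series (fun k => poisson_pmf 1 k * gshift f k) n +
   series (fun k => poisson_pmf 1 k * gshift g k) n) @ \oo --> c * expect_ZsY s f + expect_ZsY s g.
  by apply: cvgD; [apply: cvgMl_tmp; exact: cvg_ZsY|exact: cvg_ZsY].
suff e : series (fun k => poisson_pmf 1 k * gshift (fun x => c * f x + g x) k) =
  (fun n => c * series (fun k => poisson_pmf 1 k * gshift f k) n +
   series (fun k => poisson_pmf 1 k * gshift g k) n).
  by rewrite e in h1; exact: (cvg_unique _ h1 h2).
apply/funext => n; rewrite /series /= mulr_sumr -big_split; apply: eq_bigr => k _ /=.
rewrite /gshift gexpD; [|exact/gint_scale/gint_shift|exact: gint_shift].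
by rewrite gexpZ; [ring|exact: gint_shift].
Qed.

Lemma sum_poisson_id m : \sum_(k < m) poisson_pmf (1 : R) k * k%:R <= 1.
Proof.
case: m => [|m]; first by rewrite big_ord0.
rewrite big_ord_recl mulr0 add0r (le_trans _ (sum_poisson_le1 R m)) //.
apply: ler_sum => k _; rewrite /poisson_pmf ltr01 !expr1n !mul1r lift0 factS natrM.
have k0 : (k.+1%:R : R) != 0 by rewrite pnatr_eq0.
by rewrite invfM mulrAC [_ * k.+1%:R]mulrAC mulVf // mul1r.
Qed.

Lemma abs_s : `|s| <= 1.
Proof. by rewrite -(@ler_pXn2r _ 2) ?nnegrE // expr1n real_normK ?num_real. Qed.

Lemma sg_le1 : 0 <= sg <= 1.
Proof.
rewrite sqrtr_ge0 /= -[X in _ <= X]sqrtr1 ler_wsqrtr //.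
by rewrite lerBlDr lerDl sqr_ge0.
Qed.

(** The first absolute moment of the limit is at most that of a standard normal variable plus the
    mean of [Y], as [sg] and [|s|] are at most [1]. *)
Lemma expect_ZsY_dist f g (e K : R) : bcont f -> bcont g -> 0 <= e -> 0 <= K ->
  (forall x, `|f x - g x| <= e + K * `|x|) ->
  `|expect_ZsY s f - expect_ZsY s g| <= e + K * (gexp (fun x : R => `|x|) + 1).
Proof.
move=> bf bg e0 K0 h; set G := gexp _.
have gabs : gint (fun x : R => `|x|).
  apply: gint_norm; have := @gint_mulx R (fun=> 1) 1.
  have -> : (fun x : R => x * 1) = id by apply/funext => x; rewrite mulr1.
  by apply => // x; rewrite normr1.
have G0 : 0 <= G by rewrite -[X in X <= _]gexp_cst; apply: le_gexp => //; exact: gint_cst.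
have -> : expect_ZsY s f - expect_ZsY s g = expect_ZsY s (fun x => (- 1) * g x + f x).
  by rewrite expect_ZsY_lin // mulN1r addrC.
have bd := bcont_lin (- 1) bg bf.
have gk k : `|gshift (fun x => (- 1) * g x + f x) k| <= (e + K * G) + K * k%:R.
  apply: (le_trans (ler_norm_gexp (gint_shift k bd))).
  have -> : e + K * G + K * k%:R = gexp (fun x => K * `|x| + (e + K * k%:R)).
    rewrite gexpD; [|exact: gint_scale|exact: gint_cst].
    by rewrite gexpZ // gexp_cst /G; ring.
  apply: le_gexp; [exact: (gint_norm (gint_shift k bd))|apply: gint_add; [exact: gint_scale|exact: gint_cst]|].
  move=> x; rewrite mulN1r addrC (le_trans (h _)) //.
  rewrite [X in _ <= X]addrCA lerD2l -mulrDr ler_wpM2l //.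
  apply: (le_trans (ler_normD _ _)); apply: lerD; rewrite normrM.
    by have /andP[? ?] := sg_le1; rewrite ger0_norm // ler_piMl.
  by rewrite (ger0_norm (ler0n _ _)) ler_piMl ?abs_s.
have c := cvg_ZsY bd.
rewrite -(cvg_lim _ c) // -lim_norm; last by apply/cvg_ex; eexists; exact: c.
apply: limr_le; first by apply: is_cvg_norm; apply/cvg_ex; eexists; exact: c.
near=> m; rewrite /series /= big_mkord (le_trans (ler_norm_sum _ _ _)) //.
apply: (@le_trans _ _ (\sum_(k < m) ((e + K * G) * poisson_pmf 1 k + K * (poisson_pmf 1 k * k%:R)))).
  apply: ler_sum => k _; rewrite normrM (ger0_norm (poisson_pmf_ge0 _ _)).
  rewrite (le_trans (ler_wpM2l (poisson_pmf_ge0 _ _) (gk k))) //.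
  by rewrite le_eqVlt; apply/orP; left; apply/eqP; ring.
rewrite big_split /= -!mulr_sumr mulrDr mulr1 addrA.
by apply: lerD; rewrite ler_piMr ?sum_poisson_le1 ?sum_poisson_id // addr_ge0 // mulr_ge0.
Unshelve. all: by end_near. Qed.

Lemma expect_ZsY_cos (t b : R) :
  expect_ZsY s (fun x => cos (t * x + b)) =
  expR (- ((1 - s ^+ 2) / 2 * t ^+ 2)) *
   \big[+%R/0%R]_(0 <= k <oo) (poisson_pmf 1 k * cos (t * s * k%:R + b)).
Proof.
have hC k : `|cos (t * s * k%:R + b)| <= 1 by exact: cos_le1_norm.
have h1 := cvg_ZsY (bcont_cos t b).
have h2 := is_cvg_poisson_series hC.
set c := expR _.
have h3 : (fun n => c * series (fun k => poisson_pmf 1 k * cos (t * s * k%:R + b)) n) @ \oo -->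
   c * \big[+%R/0%R]_(0 <= k <oo) (poisson_pmf 1 k * cos (t * s * k%:R + b)).
  by apply: cvgMl_tmp; exact: h2.
suff e : series (fun k => poisson_pmf 1 k * gshift (fun x => cos (t * x + b)) k) =
  (fun n => c * series (fun k => poisson_pmf 1 k * cos (t * s * k%:R + b)) n).
  by rewrite e in h1; exact: (cvg_unique _ h1 h3).
apply/funext => n; rewrite /series /= mulr_sumr; apply: eq_bigr => k _.
rewrite mulrCA; congr (_ * _); rewrite /gshift.
have -> : (fun x => cos (t * (sg * x + s * k%:R) + b)) =
   (fun x => cos ((t * sg) * x + (t * s * k%:R + b))).
  by apply/funext => x; congr cos; ring.
rewrite gauss_char /c; congr (expR _ * _); rewrite exprMn sqr_sqrtr ?subr_ge0 //; ring.
Qed.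

End limit_law.

Lemma cos_lipschitz (R : realType) (u v : R) : `|cos u - cos v| <= `|u - v|.
Proof.
have d (c : R) : is_derive c 1 (fun x : R => cos (1 * x + v)) (- sin (1 * c + v)).
  have h := is_derive_affine 1 v c.
  have -> : (fun x : R => cos (1 * x + v)) = cos \o (fun x : R => 1 * x + v) by [].
  by apply: is_derive_eq; rewrite /GRing.scale /=; ring.
have := @mvt_bound R _ _ (u - v) 1 d.
rewrite mul1r subrK mulr0 add0r mul1r; apply => c _ _.
by rewrite normrN sin_le1_norm.
Qed.

Lemma perm_mx_orthogonal (R : realType) n (s : 'S_n) : orthogonal (perm_mx s : 'M[R]_n).
Proof. by rewrite /orthogonal tr_perm_mx -perm_mxM mulgV perm_mx1. Qed.

(** * Estimates in fixed dimension *)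

Section finite_n.
Variables (R : realType) (n : nat) (A : 'M[R]_n) (mu : probability (mxBorel R n) R).
Hypotheses (Hmu : is_Haar_On mu) (trA : \tr (A^T *m A) = n%:R) (n4 : (4 <= n)%N).
Let sn : R := (n%:R)^-1 * \sum_(i < n) A i i.
Let A0 : 'M[R]_n := A - sn%:M.
Local Notation Pm s := (perm_mx s : 'M[R]_n).
Local Notation TrX s := (fun M : 'M[R]_n => \tr (A *m M *m Pm s *m M^T)).
Local Notation Ex := (expect_TrAMPMt mu A).

Let N0 : (n%:R : R) != 0. Proof. by rewrite pnatr_eq0 -lt0n (leq_trans _ n4). Qed.
Let snE : n%:R * sn = \tr A. Proof. by rewrite /sn mulrA divff // mul1r. Qed.

Let trA0 : \tr A0 = 0.
Proof. by rewrite /A0 raddfB /= mxtrace_scalar -[X in _ - X]mulr_natl snE subrr. Qed.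

Let nrmA0 : nrm A0 = n%:R * (1 - sn ^+ 2).
Proof.
rewrite nrmE /A0 [(_ - _)^T]raddfB /= tr_scalar_mx !(mulmxBl, mulmxBr) !raddfB /= trA.
rewrite mul_mx_scalar mul_scalar_mx !mxtraceZ mxtrace_tr -scalar_mxM mxtrace_scalar -snE.
by rewrite -[(sn * sn) *+ n]mulr_natl; ring.
Qed.

Lemma sn_sqr_le1 : sn ^+ 2 <= 1.
Proof.
have := nrm_ge0 A0; rewrite nrmA0 pmulr_rge0 ?subr_ge0 //.
by rewrite ltr0n (leq_trans _ n4).
Qed.

Let s01 : 0 <= 1 - sn ^+ 2 <= 1.
Proof. by rewrite subr_ge0 sn_sqr_le1 lerBlDr lerDl sqr_ge0. Qed.

Lemma trace_decomp s M : orthogonal M -> TrX s M = linO A0 (Pm s) M + sn * (fixp s)%:R.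
Proof.
move=> oM; rewrite /linO /A0 mulmxBl raddfB /= mul_scalar_mx mxtraceZ trace_conjO //.
by rewrite mxtrace_perm subrK /conjO !mulmxA.
Qed.

Lemma nice_X s : nice (TrX s).
Proof.
have -> : TrX s = linO A (Pm s) by apply/funext => M; rewrite /linO /conjO !mulmxA.
exact: nice_linO.
Qed.

Lemma ExE f : Ex f = pavg (fun s => expec mu (fun M => f (TrX s M))).
Proof. by []. Qed.

Lemma nice_fX f s : bcont f -> nice (fun M => f (TrX s M)).
Proof. by move=> [cf bf]; apply: nice_comp => //; exact: nice_X. Qed.

Lemma Ex_lin c f g : bcont f -> bcont g -> Ex (fun x => c * f x + g x) = c * Ex f + Ex g.
Proof.
move=> bf bg; rewrite !ExE -pavgZ -pavgD; congr pavg; apply/funext => s.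
have nf := nice_fX s bf; have ng := nice_fX s bg.
by rewrite expecD ?expecZ //; apply: nice_mul => //; exact: nice_cst.
Qed.

(** Tightness, uniformly in [n]: [10] is the bound [9] on [E |W|] plus the mean number [1] of fixed
    points. *)
Lemma Ex_dist f g (e K : R) : bcont f -> bcont g -> 0 <= e -> 0 <= K ->
  (forall x, `|f x - g x| <= e + K * `|x|) -> `|Ex f - Ex g| <= e + K * 10.
Proof.
move=> bf bg e0 K0 h.
have -> : Ex f - Ex g = Ex (fun x => (- 1) * g x + f x) by rewrite Ex_lin // mulN1r addrC.
rewrite ExE; apply: (le_trans (ler_norm_pavg _)).
have n1 : (0 < n)%N by rewrite (leq_trans _ n4).
have -> : e + K * 10 = pavg (fun s : 'S_n => (e + K * 9) + K * (fixp s)%:R).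
  rewrite pavgD pavg_cst pavgZ (_ : pavg _ = 1); first by ring.
  by case: (n) n1 => // m _; rewrite pavg_fixp.
apply: le_pavg => s.
have nd : nice (fun M => (- 1) * g (TrX s M) + f (TrX s M)) by exact: (nice_fX s (bcont_lin (- 1) bg bf)).
have nW := nice_linO A0 (Pm s).
have nV := nice_linO A0 (Pm s)^T.
have W9 : expec mu (fun M => `|linO A0 (Pm s) M|) <= 9.
  have := expec_W_le Hmu (perm_mx_orthogonal R s) trA0 n4 s01 nrmA0.
  have : 0 <= expec mu (fun M => `|linO A0 (Pm s)^T M|).
    rewrite -[X in X <= _](expec_cst mu); apply: le_expec => //; [exact: nice_cst|exact: nice_norm].
  lra.
apply: (le_trans (ler_norm_expec Hmu nd)).
apply: (@le_trans _ _ (expec mu (fun M => (e + K * (fixp s)%:R) + K * `|linO A0 (Pm s) M|))).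
  apply: le_expec => //; first exact: nice_norm.
    apply: nice_add; first exact: nice_cst.
    by apply: nice_mul; [exact: nice_cst|exact: nice_norm].
  move=> M oM; rewrite mulN1r addrC (le_trans (h _)) // -addrA lerD2l -mulrDr ler_wpM2l //.
  rewrite trace_decomp // addrC (le_trans (ler_normD _ _)) // lerD2r normrM (ger0_norm (ler0n _ _)).
  rewrite ler_piMl // -(@ler_pXn2r _ 2) ?nnegrE // expr1n real_normK ?num_real //.
  exact: sn_sqr_le1.
rewrite expecD ?expecZ ?expec_cst //; first last.
- by apply: nice_mul; [exact: nice_cst|exact: nice_norm].
- exact: nice_cst.
- exact: nice_norm.
by rewrite addrAC lerD2r lerD2l ler_wpM2l.
Qed.

(** Averaging [65 + 2 |tr P| + |tr (P^2)|] over permutations gives at most [65 + 2 + (1 + 2) = 70],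
    since [n / (n - 2) <= 2]. *)
Lemma Ex_cos (t b : R) :
  `|Ex (fun x => cos (t * x + b)) -
    expR (- ((1 - sn ^+ 2) / 2 * t ^+ 2)) * pavg (fun s : 'S_n => cos (t * sn * (fixp s)%:R + b))|
  <= expR (t ^+ 2) * (1 + `|t|) * `|t| * 70 / Num.sqrt n%:R.
Proof.
rewrite ExE -[X in _ - X]mul1r -mulNr -pavgZ -pavgZ -pavgD.
apply: (le_trans (ler_norm_pavg _)).
set c := expR (t ^+ 2) * _ * _.
have c0 : 0 <= c by rewrite !mulr_ge0 ?expR_ge0 // addr_ge0.
have sq0 : 0 < Num.sqrt n%:R :> R by rewrite sqrtr_gt0 ltr0n (leq_trans _ n4).
have n1 : (0 < n)%N by rewrite (leq_trans _ n4).
apply: (@le_trans _ _ (pavg (fun s : 'S_n => c / Num.sqrt n%:R *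
   ((65 + 2 * (fixp s)%:R) + (fixp (s * s)%g)%:R)))).
  apply: le_pavg => s; rewrite mulN1r.
  have hb := haar_clt_bound Hmu (perm_mx_orthogonal R s) trA0 n4 s01 nrmA0 t (t * sn * (fixp s)%:R + b).
  rewrite -perm_mxM !mxtrace_perm !(ger0_norm (ler0n _ _)) -/c in hb.
  rewrite [X in _ <= X]mulrAC -[X in _ <= X]mulrA; apply: le_trans hb.
  rewrite le_eqVlt; apply/orP; left; apply/eqP; congr (`|_ - _|).
  apply: eq_expec => //.
  - exact: (nice_fX s (bcont_cos t b)).
  - apply: nice_cos; apply: nice_add; last exact: nice_cst.
    by apply: nice_mul; [exact: nice_cst|exact: nice_linO].
  move=> M oM; rewrite trace_decomp //; congr cos; ring.
rewrite pavgZ mulrAC ler_pM2r ?invr_gt0 // ler_wpM2l // pavgD pavgD pavgZ pavg_cst.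
have := @pavg_fixp_sqr R n (leq_trans (isT : 3 <= 4)%N n4).
have -> : pavg (fun s : 'S_n => (fixp s)%:R) = 1 :> R by case: (n) n1 => // m _; rewrite pavg_fixp.
have : n%:R / (n%:R - 2) <= 2 :> R.
  have : 4 <= n%:R :> R by rewrite ler_nat.
  by move=> ?; rewrite ler_pdivrMr; lra.
lra.
Qed.

End finite_n.

Section main.
Variables (R : realType) (A : forall n : nat, 'M[R]_n) (s : R).
Variable mu : forall n : nat, probability (mxBorel R n) R.
Hypothesis trA : forall n, \tr ((A n)^T *m A n) = n%:R.
Hypothesis sA : (fun n => (n%:R)^-1 * \sum_(i < n) A n i i) @ \oo --> s.
Hypothesis Hmu : forall n, is_Haar_On (mu n).
Let sn (n : nat) : R := (n%:R)^-1 * \sum_(i < n) A n i i.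
Local Notation Ex n f := (expect_TrAMPMt (mu n) (A n) f).

Lemma s_sqr_le1 : s ^+ 2 <= 1.
Proof.
have c : (fun n => sn n ^+ 2) @ \oo --> s ^+ 2.
  by under eq_fun do rewrite expr2; rewrite expr2; apply: cvgM; exact: sA.
rewrite -(cvg_lim _ c) //; apply: limr_le; first by apply/cvg_ex; eexists; exact: c.
near=> n; apply: sn_sqr_le1 => //; near: n; exact: nbhs_infty_ge.
Unshelve. all: by end_near. Qed.

Lemma cvg_Ex_cos (t b : R) :
  (fun n => Ex n (fun x => cos (t * x + b))) @ \oo --> expect_ZsY s (fun x => cos (t * x + b)).
Proof.
rewrite expect_ZsY_cos ?s_sqr_le1 //.
set S := limn _.
pose c (v : R) : R := expR (- ((1 - v ^+ 2) / 2 * t ^+ 2)).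
pose p n := pavg (fun u : 'S_n => cos (t * s * (fixp u)%:R + b)) : R.
pose pn n := pavg (fun u : 'S_n => cos (t * sn n * (fixp u)%:R + b)) : R.
have cp : p @ \oo --> S by apply: (@cvg_pavg_poisson R (fun k => cos (t * s * k%:R + b)) 1) => k; exact: cos_le1_norm.
(* Replacing [s] by [sn n] in the phase costs at most [|t| |sn n - s|], as cosine is 1-Lipschitz and
   the mean number of fixed points is one. *)
have cpn : pn @ \oo --> S.
  have d : (fun n => pn n - p n) @ \oo --> (0 : R).
    have cd : (fun n => `|t| * `|sn n - s|) @ \oo --> `|t| * `|s - s|.
      apply: cvgMl_tmp; apply: cvg_norm; apply: cvgB; [exact: sA|exact: cvg_cst].
    rewrite subrr normr0 mulr0 in cd.
    apply/norm_cvg0P; apply: (squeeze_cvgr _ (cvg_cst 0) cd); near=> n.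
    rewrite normr_ge0 /=.
    have n1 : (0 < n)%N by near: n; exact: nbhs_infty_gt.
    have -> : pn n - p n = pavg (fun u : 'S_n => cos (t * sn n * (fixp u)%:R + b) + (- 1) * cos (t * s * (fixp u)%:R + b)).
      by rewrite pavgD pavgZ mulN1r.
    apply: (le_trans (ler_norm_pavg _)).
    have -> : `|t| * `|sn n - s| = pavg (fun u : 'S_n => (`|t| * `|sn n - s|) * (fixp u)%:R).
      rewrite pavgZ (_ : pavg _ = 1) ?mulr1 //.
      by rewrite -(ltn_predK n1) pavg_fixp.
    apply: le_pavg => u; rewrite mulN1r (le_trans (cos_lipschitz _ _)) //.
    have -> : t * sn n * (fixp u)%:R + b - (t * s * (fixp u)%:R + b) = t * (sn n - s) * (fixp u)%:R by ring.
    by rewrite !normrM (ger0_norm (ler0n _ _)).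
  have -> : pn = (fun n => (pn n - p n) + p n) by apply/funext => n; rewrite subrK.
  by rewrite -[S]add0r; exact: cvgD.
have cc : (fun n => c (sn n)) @ \oo --> c s.
  have cont : continuous c.
    move=> v; apply: (@continuous_comp _ _ _ (fun v : R => - ((1 - v ^+ 2) / 2 * t ^+ 2)) expR); last exact: continuous_expR.
    apply: cvgN; apply: cvgMr_tmp; apply: cvgMr_tmp; apply: cvgB; first exact: cvg_cst.
    exact: sqr_continuous.
  exact: (@cvg_comp _ _ _ sn c _ _ _ sA (cont s)).
have main : (fun n => c (sn n) * pn n) @ \oo --> c s * S by exact: cvgM.
have err : (fun n => Ex n (fun x => cos (t * x + b)) - c (sn n) * pn n) @ \oo --> (0 : R).
  have cd : (fun n => expR (t ^+ 2) * (1 + `|t|) * `|t| * 70 / Num.sqrt n%:R) @ \oo --> (0 : R).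
    set k := expR _ * _ * _ * _.
    have k0 : 0 <= k by rewrite !mulr_ge0 ?expR_ge0 // addr_ge0.
    apply/cvgrPdist_le => e e0; near=> n.
    have n1 : (0 < n)%N by near: n; exact: nbhs_infty_gt.
    have sq0 : 0 < Num.sqrt n%:R :> R by rewrite sqrtr_gt0 ltr0n.
    rewrite sub0r normrN ger0_norm ?divr_ge0 ?(ltW sq0) // ler_pdivrMr // mulrC -ler_pdivrMr //.
    rewrite -(@ler_pXn2r _ 2) ?nnegrE ?divr_ge0 ?(ltW e0) ?(ltW sq0) // sqr_sqrtr ?ler0n //.
    near: n; exact: nbhs_infty_ger.
  apply/norm_cvg0P; apply: (squeeze_cvgr _ (cvg_cst 0) cd); near=> n.
  rewrite normr_ge0 /=; apply: Ex_cos => //; near: n; exact: nbhs_infty_ge.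
have -> : (fun n => Ex n (fun x => cos (t * x + b))) = (fun n =>
   (Ex n (fun x => cos (t * x + b)) - c (sn n) * pn n) + c (sn n) * pn n).
  by apply/funext => n; rewrite subrK.
by rewrite -[X in _ --> X]add0r; exact: cvgD.
Unshelve. all: by end_near. Qed.

Lemma cvg_Ex_trig q : is_trig q -> (fun n => Ex n q) @ \oo --> expect_ZsY s q.
Proof.
move=> [l ->]; elim: l => [|p l ih].
  (* Zero is written as a combination of cosines so that linearity evaluates both sides. *)
  have -> : trig_poly [::] = (fun x : R => (- 1) * cos (0 * x + 0) + cos (0 * x + 0)).
    by apply/funext => x; rewrite /trig_poly big_nil mulN1r addNr.
  have bc := bcont_cos (0 : R) 0; rewrite expect_ZsY_lin // mulN1r addNr.
  have -> : (fun n => Ex n (fun x : R => (- 1) * cos (0 * x + 0) + cos (0 * x + 0))) = (fun=> 0).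
    by apply/funext => n; rewrite Ex_lin // mulN1r addNr.
  exact: cvg_cst.
have bl : bcont (trig_poly l) by apply: bcont_trig; exists l.
have bc := bcont_cos p.1.2 p.2.
have -> : trig_poly (p :: l) = (fun x => p.1.1 * cos (p.1.2 * x + p.2) + trig_poly l x).
  by apply/funext => x; rewrite /trig_poly big_cons.
rewrite expect_ZsY_lin //.
have -> : (fun n => Ex n (fun x => p.1.1 * cos (p.1.2 * x + p.2) + trig_poly l x)) =
  (fun n => p.1.1 * Ex n (fun x => cos (p.1.2 * x + p.2)) + Ex n (trig_poly l)).
  by apply/funext => n; rewrite Ex_lin.
by apply: cvgD => //; apply: cvgMl_tmp; exact: cvg_Ex_cos.
Qed.

Lemma cvg_Ex f : bcont f -> (fun n => Ex n f) @ \oo --> expect_ZsY s f.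
Proof.
move=> bf; have [cf [C hC]] := bf.
have C0 : 0 <= C := le_trans (normr_ge0 _) (hC 0).
apply/cvgrPdist_le => e e0.
have e5 : 0 < e / 5 by rewrite divr_gt0.
pose G : R := gexp (fun x : R => `|x|) + 1.
have G0 : 0 <= G.
  rewrite addr_ge0 // /gexp; apply: Rintegral_ge0 => x _; by rewrite mulr_ge0 // pdf_ge0.
(* Beyond [L] the difference [|f - q|] is at most [2 C <= K |x|], and this [L] makes
   [K (G + 10) <= e / 5]; the [+ 1] keeps it positive when [C = 0]. The five parts of [e] are two
   for each of the two comparisons and one for the convergence at [q]. *)
pose L : R := 2 * C * (G + 10) / (e / 5) + 1.
have L0 : 0 < L by rewrite ltr_wpDl // divr_ge0 ?(ltW e5) // !mulr_ge0 // addr_ge0.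
have [q [tq qC fq]] := trig_approx cf hC L0 e5.
pose K : R := 2 * C / L.
have K0 : 0 <= K by rewrite divr_ge0 ?(ltW L0) // mulr_ge0.
have KG : K * (G + 10) <= e / 5.
  rewrite /K mulrAC ler_pdivrMr // /L [X in _ <= X]mulrDr mulr1 [X in _ <= X + _]mulrCA.
  by rewrite divff ?gt_eqF // mulr1 ler_wpDr // ltW.
have dist x : `|f x - q x| <= e / 5 + K * `|x|.
  have [xL|xL] := lerP `|x| L; first by rewrite ler_wpDr ?fq // mulr_ge0.
  rewrite ler_wpDl ?(ltW e5) // (le_trans (ler_normB _ _)) //.
  apply: (@le_trans _ _ (2 * C)); first by have := hC x; have := qC x; lra.
  by rewrite /K -mulrA ler_peMr ?mulr_ge0 // mulrC ler_pdivlMr // mul1r ltW.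
have bq := bcont_trig tq.
have h1 := expect_ZsY_dist s_sqr_le1 bf bq (ltW e5) K0 dist.
have /cvgrPdist_le/(_ _ e5) cq := cvg_Ex_trig tq.
near=> n.
have n4 : (4 <= n)%N by near: n; exact: nbhs_infty_ge.
have h2 := Ex_dist (Hmu n) (trA n) n4 bf bq (ltW e5) K0 dist.
have h3 : `|expect_ZsY s q - Ex n q| <= e / 5 by near: n.
have K10 : K * 10 <= e / 5 by apply: le_trans KG; rewrite ler_wpM2l // lerDr.
have KG1 : K * G <= e / 5 by apply: le_trans KG; rewrite ler_wpM2l // lerDl.
move: h1 h2 h3; rewrite -/G !ler_norml => /andP[? ?] /andP[? ?] /andP[? ?].
apply/andP; split; lra.
Unshelve. all: by end_near. Qed.

End main.

Theorem theorem3p4 (R : realType) (A : forall n : nat, 'M[R]_n) (s : R)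
    (mu : forall n : nat, probability (mxBorel R n) R) :
  (forall n, \tr ((A n)^T *m A n) = n%:R) ->
  (fun n => (n%:R)^-1 * \sum_(i < n) A n i i) @ \oo --> s ->
  (forall n, is_Haar_On (mu n)) ->
  cvg_in_distribution (fun n f => expect_TrAMPMt (mu n) (A n) f)
                      (expect_ZsY s).
Proof.
by move=> trA sA Hmu f cf bf; exact: cvg_Ex.
Qed.
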